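(* Suppose that $d=2$ and $k\ge4$, or that $d\ge3$ and $k\ge3$ ($d,k$ integers). If $f\in\mathbb{C}\langle\langle x_1,\dots,x_d\rangle\rangle$ has order $k$, then the $\mathfrak{J}$-dimension of $\mathrm{Jac}(f)$ is at least $3$.
   Context: $\mathbb{C}\langle\langle x_1,\dots,x_d\rangle\rangle$ is the ring of formal power series in $d$ noncommuting variables over $\mathbb{C}$, with two-sided maximal ideal $\mathfrak{n}$ of series with zero constant term and the $\mathfrak{n}$-adic topology; the closure of a subset $S$ is $\bigcap_{i\ge0}(S+\mathfrak{n}^i)$. The order of $f=\sum_if_i$ (with $f_i$ homogeneous of degree $i$) is $\min\{i\mid f_i\ne0\}$. The cyclic derivative $\delta_i$ is the $\mathbb{C}$-linear (termwise) map with $\delta_i(x_{i_1}\cdots x_{i_t})=\sum_{j:\,i_j=i}x_{i_{j+1}}\cdots x_{i_t}x_{i_1}\cdots x_{i_{j-1}}$. $\mathrm{Jac}(f)$ is the quotient of $\mathbb{C}\langle\langle x_1,\dots,x_d\rangle\rangle$ by the closure of the two-sided ideal $(\delta_1f,\dots,\delta_df)$, and $\mathfrak{J}$ is its Jacobson radical. The $\mathfrak{J}$-dimension of $\mathrm{Jac}(f)$ is the infimum of those real $r\ge0$ for which there is $c\in\mathbb{R}$ with $\dim_{\mathbb{C}}\mathrm{Jac}(f)/\mathfrak{J}^n\le cn^r$ for all $n\in\mathbb{N}$ (and is $\infty$ if no such $r$ exists). *)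

(* Defs.v *)
From HB Require Import structures.
From mathcomp Require Import all_boot all_order all_algebra ring_quotient zify.
From mathcomp Require Import generic_quotient.
From mathcomp Require Import all_classical all_reals all_analysis.
From mathcomp Require Export complex.

Set Implicit Arguments.
Unset Strict Implicit.
Unset Printing Implicit Defensive.

Import Order.TTheory GRing.Theory Num.Theory.
Local Open Scope classical_set_scope.
Local Open Scope ring_scope.

Section Ideals.
Variable A : pzRingType.
Implicit Types (I J X : set A).

Definition is_left_ideal I :=
  [/\ I 0, (forall x y, I x -> I y -> I (x - y))
    & forall a x, I x -> I (a * x)].

Definition is_ideal I :=
  is_left_ideal I /\ forall a x, I x -> I (x * a).

Definition ideal_gen X : set A := smallest is_ideal X.

Definition ideal_mul I J : set A :=
  [set z | exists m (a b : 'I_m -> A),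
     [/\ forall i, I (a i), forall i, J (b i) & z = \sum_(i < m) a i * b i]].

Fixpoint ideal_exp I n : set A :=
  if n is n'.+1 then ideal_mul I (ideal_exp I n') else setT.

Definition is_max_left_ideal I :=
  [/\ is_left_ideal I, I <> setT
    & forall J, is_left_ideal J -> I `<=` J -> J = I \/ J = setT].

Definition jacobson_radical : set A :=
  \bigcap_(I in is_max_left_ideal) I.

Lemma is_ideal_gen X : is_ideal (ideal_gen X).
Proof.
split; first split.
- by move=> I [[[]]].
- move=> x y Ix Iy I II; have [[[_ IB _] _] _] := II.
  by apply: IB; [exact: Ix | exact: Iy].
- move=> a x Ix I II; have [[[_ _ IM] _] _] := II.
  by apply: IM; exact: Ix.
- move=> a x Ix I II; have [[_ IM] _] := II.
  by apply: IM; exact: Ix.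
Qed.

Lemma is_ideal_mul I J : is_ideal I -> is_ideal J -> is_ideal (ideal_mul I J).
Proof.
move=> [[I0 IB Il] Ir] [[J0 JB Jl] Jr]; split; first split.
- by exists 0, (fun=> 0), (fun=> 0); split => //; rewrite big_ord0.
- move=> _ _ [m [a [b [Ia Jb ->]]]] [n [a' [b' [Ia' Jb' ->]]]].
  exists (m + n)%N,
    (fun i => match fintype.split i with inl j => a j | inr j => - a' j end),
    (fun i => match fintype.split i with inl j => b j | inr j => b' j end).
  split.
  + move=> i; case: fintype.split => // j.
    by rewrite -[- _]add0r; apply: IB.
  + by move=> i; case: fintype.split.
  + rewrite big_split_ord /= -sumrN; congr (_ + _); apply: eq_bigr => i _.
      by rewrite (unsplitK (inl i)).
    by rewrite (unsplitK (inr i)) mulNr.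
- move=> c _ [m [a [b [Ia Jb ->]]]]; exists m, (fun i => c * a i), b.
  split=> // [i|]; first exact: Il.
  by rewrite mulr_sumr; apply: eq_bigr => i _; rewrite mulrA.
- move=> c _ [m [a [b [Ia Jb ->]]]]; exists m, a, (fun i => b i * c).
  split=> // [i|]; first exact: Jr.
  by rewrite mulr_suml; apply: eq_bigr => i _; rewrite mulrA.
Qed.

Lemma is_ideal_exp I n : is_ideal I -> is_ideal (ideal_exp I n).
Proof. by move=> II; elim: n => [|n IHn] //=; exact: is_ideal_mul. Qed.

Lemma is_ideal_add I J : is_ideal I -> is_ideal J ->
  is_ideal [set x + y | x in I & y in J].
Proof.
move=> [[I0 IB Il] Ir] [[J0 JB Jl] Jr]; split; first split.
- by exists 0 => //; exists 0 => //; rewrite addr0.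
- move=> _ _ [x Ix [y Jy <-]] [x' Ix' [y' Jy' <-]].
  exists (x - x'); first exact: IB.
  by exists (y - y'); [exact: JB | rewrite opprD addrACA].
- move=> c _ [x Ix [y Jy <-]]; exists (c * x); first exact: Il.
  by exists (c * y); [exact: Jl | rewrite mulrDr].
- move=> c _ [x Ix [y Jy <-]]; exists (x * c); first exact: Ir.
  by exists (y * c); [exact: Jr | rewrite mulrDl].
Qed.

Lemma is_ideal_bigcap (T : Type) (F : T -> set A) :
  (forall i, is_ideal (F i)) -> is_ideal (\bigcap_i F i).
Proof.
move=> HF; split; first split.
- by move=> i _; have [[]] := HF i.
- move=> x y Fx Fy i _; have [[_ FB _] _] := HF i.
  by apply: FB; [exact: Fx | exact: Fy].
- by move=> c x Fx i _; have [[_ _ FM] _] := HF i; apply: FM; exact: Fx.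
- by move=> c x Fx i _; have [_ FM] := HF i; apply: FM; exact: Fx.
Qed.

End Ideals.

Record ideal (A : pzRingType) :=
  Ideal { ideal_set : set A; idealP : is_ideal ideal_set }.

Definition ideal_pred (A : pzRingType) (I : ideal A) : A -> bool :=
  fun x => `[< ideal_set I x >].

Lemma ideal_pred_zmod_closed (A : pzRingType) (I : ideal A) :
  zmod_closed (ideal_pred I).
Proof.
have [[I0 IB _] _] := idealP I.
by split=> [|x y /asboolP Ix /asboolP Iy]; apply/asboolP => //; exact: IB.
Qed.

HB.instance Definition _ (A : pzRingType) (I : ideal A) :=
  GRing.isZmodClosed.Build A (ideal_pred I) (ideal_pred_zmod_closed I).

Definition ideal_zmod (A : pzRingType) (I : ideal A) : zmodClosed A :=
  GRing.ZmodClosed.clone A (ideal_pred I) _.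

Definition quot_ring (A : pzRingType) (I : ideal A) : Type :=
  Quotient.quot (ideal_zmod I).

Section QuotientRing.
Local Open Scope quotient_scope.
Variables (A : pzRingType) (I : ideal A).
Local Notation Q := (quot_ring I).

HB.instance Definition _ := GRing.Zmodule.on Q.
HB.instance Definition _ : EqQuotient A (Quotient.equiv (ideal_zmod I)) Q :=
  EqQuotient.on Q.

Lemma quot_ring_eqP (x y : A) :
  reflect (ideal_set I (x - y)) (\pi_Q x == \pi_Q y).
Proof. by rewrite -Quotient.idealrBE; apply: asboolP. Qed.

Lemma quot_ring_repr (x : A) : ideal_set I (repr (\pi_Q x) - x).
Proof. by apply/quot_ring_eqP; rewrite reprK. Qed.

Lemma quot_ring_pi_add : {morph \pi_Q : x y / x + y}.
Proof. exact: (@Quotient.pi_add A (ideal_zmod I)). Qed.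

Definition quot_one : Q := \pi_Q 1.
Definition quot_mul (x y : Q) : Q := \pi_Q (repr x * repr y).

Lemma quot_pi_mul : {morph \pi_Q : x y / x * y >-> quot_mul x y}.
Proof.
have [[I0 IB Il] Ir] := idealP I.
move=> x y; apply/esym/eqP/quot_ring_eqP.
rewrite -(subrKA (repr (\pi_Q x) * y)) -mulrBr -mulrBl.
rewrite -[X in _ + X]opprK; apply: (IB); first exact/Il/quot_ring_repr.
rewrite -mulNr opprB; apply: Ir.
by rewrite -opprB -[- _]add0r; apply: IB => //; exact: quot_ring_repr.
Qed.

Lemma quot_mulA : associative quot_mul.
Proof.
elim/quotW=> x; elim/quotW=> y; elim/quotW=> z.
by rewrite -(quot_pi_mul y z) -(quot_pi_mul x y) -(quot_pi_mul x) -quot_pi_mul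
  mulrA.
Qed.

Lemma quot_mul1r : left_id quot_one quot_mul.
Proof. by elim/quotW=> x; rewrite -(quot_pi_mul 1 x) mul1r. Qed.

Lemma quot_mulr1 : right_id quot_one quot_mul.
Proof. by elim/quotW=> x; rewrite -(quot_pi_mul x 1) mulr1. Qed.

Lemma quot_mulDl : left_distributive quot_mul +%R.
Proof.
elim/quotW=> x; elim/quotW=> y; elim/quotW=> z.
by rewrite -quot_ring_pi_add -(quot_pi_mul x) -(quot_pi_mul y) -quot_pi_mul
  -quot_ring_pi_add mulrDl.
Qed.

Lemma quot_mulDr : right_distributive quot_mul +%R.
Proof.
elim/quotW=> x; elim/quotW=> y; elim/quotW=> z.
by rewrite -quot_ring_pi_add -(quot_pi_mul x y) -(quot_pi_mul x z) -quot_pi_mul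
  -quot_ring_pi_add mulrDr.
Qed.

HB.instance Definition _ := GRing.Zmodule_isPzRing.Build Q
  quot_mulA quot_mul1r quot_mulr1 quot_mulDl quot_mulDr.

End QuotientRing.

(* The quotient is equipped with a ring structure and a K-module structure
   separately: MathComp's algebra structures exclude the zero ring. *)
Section QuotientModule.
Local Open Scope quotient_scope.
Variables (K : comNzRingType) (A : algType K) (I : ideal A).
Local Notation Q := (quot_ring I).

Definition quot_scale (c : K) (x : Q) : Q := \pi_Q (c *: repr x).

Lemma quot_pi_scale c : {morph \pi_Q : x / c *: x >-> quot_scale c x}.
Proof.
have [[_ IB Il] Ir] := idealP I.
move=> x; apply/esym/eqP/quot_ring_eqP.
rewrite -scalerBr -[X in _ *: X]mul1r scalerAl.
exact/Il/quot_ring_repr.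
Qed.

Lemma quot_scaleA a b x : quot_scale a (quot_scale b x) = quot_scale (a * b) x.
Proof.
by elim/quotW: x => x; rewrite -(quot_pi_scale b x) -!quot_pi_scale scalerA.
Qed.

Lemma quot_scale1r : left_id 1 quot_scale.
Proof. by elim/quotW=> x; rewrite -(quot_pi_scale 1 x) scale1r. Qed.

Lemma quot_scaleDr : right_distributive quot_scale +%R.
Proof.
move=> c; elim/quotW=> x; elim/quotW=> y.
by rewrite -quot_ring_pi_add -!quot_pi_scale -quot_ring_pi_add scalerDr.
Qed.

Lemma quot_scaleDl x : {morph quot_scale^~ x : a b / a + b}.
Proof.
move=> a b; elim/quotW: x => x.
by rewrite -!quot_pi_scale -quot_ring_pi_add scalerDl.
Qed.

HB.instance Definition _ := GRing.Zmodule_isLmodule.Build K Q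
  quot_scaleA quot_scale1r quot_scaleDr quot_scaleDl.

End QuotientModule.

(* dim_K (V / W), possibly infinite: the supremum of the sizes of the finite
   families of V that are linearly independent modulo the subspace W. *)
Definition quot_dim (R : realType) (K : fieldType) (V : lmodType K)
    (W : set V) : \bar R :=
  ereal_sup [set (m%:R)%:E | m in
    [set m | exists v : 'I_m -> V, forall c : 'I_m -> K,
       W (\sum_(i < m) c i *: v i) -> forall i, c i = 0]].

(* K<<x_0, ..., x_(d-1)>>: the word [:: i_1; ...; i_t] stands for the monomial
   x_(i_1) ... x_(i_t), and a series is the family of its coefficients. *)
Definition ncseries (K : Type) (d : nat) : Type := seq 'I_d -> K.

Section NCSeries.
Variables (K : fieldType) (d : nat).
Local Notation S := (ncseries K d).
Implicit Types (f g h : S) (u w : seq 'I_d).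

HB.instance Definition _ := GRing.Lmodule.copy S (seq 'I_d -> K^o).

Definition ncmono u : S := fun w => (w == u)%:R.

Definition ncmul f g : S :=
  fun w => \sum_(m < (size w).+1) f (take m w) * g (drop m w).

Definition ncshift (i : 'I_d) f : S := fun w => f (i :: w).

Lemma ncmul_nil f g : ncmul f g [::] = f [::] * g [::].
Proof. by rewrite /ncmul big_ord1. Qed.

Lemma ncmul_cons f g i w :
  ncmul f g (i :: w) = f [::] * g (i :: w) + ncmul (ncshift i f) g w.
Proof. by rewrite /ncmul big_ord_recl. Qed.

Lemma ncseriesDE f g w : (f + g) w = f w + g w. Proof. by []. Qed.
Lemma ncseriesZE c f w : (c *: f) w = c * f w. Proof. by []. Qed.

Lemma ncmulDl : left_distributive ncmul +%R.
Proof.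
move=> f g h; apply/funext => w; rewrite ncseriesDE /ncmul -big_split /=.
by apply: eq_bigr => m _; rewrite ncseriesDE mulrDl.
Qed.

Lemma ncmulDr : right_distributive ncmul +%R.
Proof.
move=> f g h; apply/funext => w; rewrite ncseriesDE /ncmul -big_split /=.
by apply: eq_bigr => m _; rewrite ncseriesDE mulrDr.
Qed.

Lemma ncscaleAl c f g : c *: ncmul f g = ncmul (c *: f) g.
Proof.
apply/funext => w; rewrite ncseriesZE /ncmul mulr_sumr.
by apply: eq_bigr => m _; rewrite ncseriesZE mulrA.
Qed.

Lemma ncscaleAr c f g : c *: ncmul f g = ncmul f (c *: g).
Proof.
apply/funext => w; rewrite ncseriesZE /ncmul mulr_sumr.
by apply: eq_bigr => m _; rewrite ncseriesZE mulrCA.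
Qed.

Lemma ncshift_mul i f g :
  ncshift i (ncmul f g) = f [::] *: ncshift i g + ncmul (ncshift i f) g.
Proof. by apply/funext => w; rewrite /ncshift ncmul_cons. Qed.

Lemma ncmulA : associative ncmul.
Proof.
move=> f g h; apply/funext => w; elim: w f g h => [|i w IHw] f g h.
  by rewrite !ncmul_nil mulrA.
rewrite !ncmul_cons ncmul_nil ncshift_mul ncmulDl ncseriesDE -IHw.
by rewrite -ncscaleAl ncseriesZE mulrDr mulrA addrA.
Qed.

Lemma ncmul1 : left_id (ncmono [::]) ncmul.
Proof.
move=> f; apply/funext => w; rewrite /ncmul big_ord_recl /ncmono take0 drop0.
rewrite eqxx mul1r big1 ?addr0 // => m _.
by case: w m => [[]|i w m] //=; rewrite mul0r.
Qed.

Lemma nc1mul : right_id (ncmono [::]) ncmul.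
Proof.
move=> f; apply/funext => w; rewrite /ncmul big_ord_recr /ncmono /=.
rewrite take_size drop_size eqxx mulr1 big1 ?add0r // => m _.
by rewrite -size_eq0 size_drop subn_eq0 leqNgt ltn_ord mulr0.
Qed.

Lemma nc1_neq0 : ncmono [::] != 0.
Proof.
apply/eqP => /(congr1 (fun f : S => f [::])); rewrite /ncmono eqxx.
exact/eqP/oner_neq0.
Qed.

HB.instance Definition _ := GRing.Zmodule_isNzRing.Build S
  ncmulA ncmul1 nc1mul ncmulDl ncmulDr nc1_neq0.
HB.instance Definition _ := GRing.Lmodule_isLalgebra.Build K S ncscaleAl.
HB.instance Definition _ := GRing.Lalgebra_isAlgebra.Build K S ncscaleAr.

Definition nc_max : set S := [set f | f [::] = 0].

Lemma is_ideal_nc_max : is_ideal nc_max.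
Proof.
split; first split.
- by [].
- move=> f g f0 g0.
  by rewrite /nc_max /= /GRing.add /= f0 add0r /GRing.opp /= g0 oppr0.
- by move=> a f f0; rewrite /nc_max /= [LHS]ncmul_nil f0 mulr0.
- by move=> a f f0; rewrite /nc_max /= [LHS]ncmul_nil f0 mul0r.
Qed.

Definition nc_closure (X : set S) : set S :=
  \bigcap_i [set x + y | x in X & y in ideal_exp nc_max i].

Lemma is_ideal_nc_closure X : is_ideal X -> is_ideal (nc_closure X).
Proof.
move=> IX; apply: is_ideal_bigcap => i; apply: is_ideal_add => //.
exact/is_ideal_exp/is_ideal_nc_max.
Qed.

Definition nc_hom f (i : nat) : S := fun w => if size w == i then f w else 0.

Definition has_order f (k : nat) : Prop :=
  nc_hom f k <> 0 /\ forall i, (i < k)%N -> nc_hom f i = 0.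

Definition cder_word (i : 'I_d) w : S :=
  \sum_(j < size w | tnth (in_tuple w) j == i)
    ncmono (drop j.+1 w ++ take j w).

(* Only the words of length |u| + 1 contribute to the coefficient of u in the
   termwise derivative, see cder_mono and cder_word_size. *)
Definition cder (i : 'I_d) f : S :=
  fun u => \sum_(w : (size u).+1.-tuple 'I_d) f w * cder_word i w u.

Lemma cder_word_size i w u : cder_word i w u != 0 -> size w = (size u).+1.
Proof.
rewrite /cder_word; apply: contraNeq => neq; rewrite fct_sumE big1 // => j _.
rewrite /ncmono; case: eqP => // E; case/eqP: neq.
by rewrite E size_cat size_drop size_take ltn_ord; have := ltn_ord j; lia.
Qed.

Lemma cder_mono i w : cder i (ncmono w) = cder_word i w.
Proof.
apply/funext => u; rewrite /cder; case: (eqVneq (size w) (size u).+1) => E.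
  rewrite (bigD1 (tcast E (in_tuple w))) //= big1 ?addr0.
    by rewrite val_tcast /ncmono eqxx mul1r.
  move=> t tw; rewrite /ncmono; case: eqP => [tE|_]; last by rewrite mul0r.
  by case/eqP: tw; apply: val_inj; rewrite /= val_tcast.
have -> : cder_word i w u = 0.
  by apply/eqP; apply: contraNT E => /cder_word_size ->.
rewrite big1 // => t _; rewrite /ncmono; case: eqP => [tE|_].
  by rewrite -tE size_tuple eqxx in E.
by rewrite mul0r.
Qed.

Definition jac_ideal f : ideal S :=
  Ideal (is_ideal_nc_closure
    (is_ideal_gen [set g | exists i : 'I_d, g = cder i f])).

Definition Jac f : Type := quot_ring (jac_ideal f).

HB.instance Definition _ f := GRing.PzRing.on (Jac f).
HB.instance Definition _ f := GRing.Lmodule.on (Jac f).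

Definition J_dim (R : realType) f : \bar R :=
  ereal_inf [set r%:E | r in
    [set r : R | 0 <= r /\ exists c : R, forall n : nat,
       (quot_dim R (ideal_exp (@jacobson_radical (Jac f)) n : set (Jac f))
          <= (c * n%:R `^ r)%:E)%E]].

End NCSeries.

(* Main.v *)
Require Import Defs.
From mathcomp Require Import all_boot all_order all_algebra.
From mathcomp Require Import zify ring.
From mathcomp Require Import all_classical all_reals all_analysis complex.

(** Write F for the ring of series in x_1, ..., x_d, m for its maximal ideal,
I for the two-sided ideal of the r_i = delta_i f, and a_n = a_n(f) for the
dimension of F/(I + m^n), which is [jdim n f].  As the image of m in Jac(f) is
a maximal left ideal, it contains the Jacobson radical, so a_n bounds the
dimension of Jac(f)/J^n from below ([quot_dim_ge_jdim]).  It remains to see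
that a_n grows at least like n^3.

_The recursion_ ([jdimS]).  An element of I is a sum of some b_i r_i and some
y_j x_j with y_j in I.  Hence, if r_i = sum_j r_ij x_j, the classes of the
vectors (sum_i b_i r_ij)_j with b in F^d form the kernel of
(F/(I + m^n))^d -> F/(I + m^(n+1)), (u_j) |-> sum u_j x_j.  They vanish for b in
I^d, and also for b = (a x_1, ..., a x_d), by the identity
sum x_i r_i = sum r_i x_i ([euler_cder]).  If f has order at least k and L is
the subspace spanned by these vectors and I^d, it follows that
  d a_n + 1 <= a_(n+1) + dim F^d / (L + (m^q)^d)   with q = n + 2 - k,
and a lower bound for a_(n+1) follows from an upper bound for the dimension of
the quotient by L.  Throughout, F^d is identified with m by
(u_i) |-> sum u_i x_i, and L becomes [jsyz f], with the constants added.

_Deformation_ ([jdim_ge_example]). On the line f_t = f_0 + t (f - f_0), the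
dimensions of I and of L modulo a power of m are lower semicontinuous in t:
they are smaller than at a given point only at the zeros of a polynomial, hence
for finitely many t ([jrank_deform]). So for a general t the codimension of L
for f_t is at most the one for f_0, while a_(n+1)(f) >= a_(n+1)(f_t), and the
recursion for f_t gives by induction on n the lower bound for a_(n+1)(f) that
an explicit f_0 provides. What f_0 must provide is an upper bound for a
codimension, that is, a spanning set.

_The potentials_ f_0 are x x y y for d = 2, k = 4 and x y z + x z y for d = 3,
k = 3.  Their relations permute blocks of letters up to sign, so that every
word is congruent up to a sign to one of y^a (xy)^b x^c, respectively
x^a y^b z^c ([corank_jsyz_normal]); the resulting bound for a_n is the number
of such words of length less than n, which is cubic in n.

For d >= 4 the bound d a_q for the codimension of L is enough: with k = 3 the
recursion reads a_(n+2) >= d a_(n+1) - d a_n + 1, so a_n at least doubles at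
each step ([jdim_double]). *)

Set Implicit Arguments.
Unset Strict Implicit.
Unset Printing Implicit Defensive.

Import Order.TTheory GRing.Theory Num.Theory.
Local Open Scope classical_set_scope.
Local Open Scope ring_scope.

(** * Coefficients, order and cyclic derivatives *)

Section Series.
Variables (K : fieldType) (d : nat).
Local Notation S := (ncseries K d).
Local Notation word := (seq 'I_d).
Implicit Types (f g h : S) (u v w : word) (i j : 'I_d).

Definition ord_ge n : set S := [set f | forall w, (size w < n)%N -> f w = 0].

Definition ncvar i : S := ncmono K [:: i].

(** Right division by a letter: [f] is its constant term plus the sum of the
[rdiv i f * x_i], see [rdivE]. *)
Definition rdiv i f : S := fun w => f (rcons w i).

(** Under the identification of F^d with the series without constant term,
[b * omega] is the vector of the [b * x_i]. *)
Definition omega : S := \sum_i ncvar i * ncvar i.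

Lemma ncsumE (I : Type) (r : seq I) (P : pred I) (F : I -> S) w :
  (\sum_(i <- r | P i) F i) w = \sum_(i <- r | P i) F i w.
Proof. by elim/big_rec2: _ => // i x y _ <-. Qed.

Lemma ncmulE f g w :
  (f * g) w = \sum_(m < (size w).+1) f (take m w) * g (drop m w).
Proof. by []. Qed.

Lemma ncoppE f w : (- f) w = - f w. Proof. by []. Qed.

Lemma ncmono1 : ncmono K [::] = 1 :> S. Proof. by []. Qed.

Lemma ncmonoM u v : ncmono K u * ncmono K v = ncmono K (u ++ v).
Proof.
apply/funext => w; rewrite ncmulE /ncmono.
have [->|neq] := eqVneq w (u ++ v).
  have lt : (size u < (size (u ++ v)).+1)%N by rewrite ltnS size_cat leq_addr.
  rewrite (bigD1 (Ordinal lt)) //= take_size_cat // drop_size_cat //.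
  rewrite !eqxx mulr1.
  rewrite big1 ?addr0 // => m /negP neqm.
  case: eqP => [E|]; last by rewrite mul0r.
  case: neqm; rewrite -val_eqE /=; move/(congr1 size): E => <-.
  by rewrite size_takel // -ltnS.
rewrite big1 // => m _; case: eqP => [E|]; last by rewrite mul0r.
case: eqP => [E'|]; last by rewrite mulr0.
by rewrite -E -E' cat_take_drop eqxx in neq.
Qed.

Lemma ncmul_var f j w i : (f * ncvar j) (rcons w i) = f w * (i == j)%:R.
Proof.
rewrite -cats1 ncmulE.
have lt : (size w < (size (w ++ [:: i])).+1)%N.
  by rewrite ltnS size_cat leq_addr.
rewrite (bigD1 (Ordinal lt)) //= take_size_cat // drop_size_cat //.
rewrite {1}/ncvar {1}/ncmono eqseq_cons andbT big1 ?addr0 // => m neqm.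
rewrite /ncvar /ncmono; case: eqP => [E|]; last by rewrite mulr0.
case/negP: neqm; rewrite -val_eqE /=.
move/(congr1 size): E; rewrite size_drop /= => E.
have := size_cat w [:: i]; rewrite /= => Es.
by apply/eqP; lia.
Qed.

Lemma ncmul_var_nil f j : (f * ncvar j) [::] = 0.
Proof. by rewrite ncmulE big_ord1 /= mulr0. Qed.

Lemma ncvar_mul f j w i : (ncvar j * f) (i :: w) = (i == j)%:R * f w.
Proof.
rewrite ncmulE big_ord_recl /= /ncvar /ncmono /= mul0r add0r big_ord_recl /=.
rewrite take0 drop0 eqseq_cons andbT big1 ?addr0 // => m _.
rewrite /= eqseq_cons; case: w m => [[]//|a w m] /=.
by rewrite andbF mul0r.
Qed.

Lemma ncvar_mul_nil f j : (ncvar j * f) [::] = 0.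
Proof. by rewrite ncmulE big_ord1 /= mul0r. Qed.

Lemma rdivE f : f = f [::] *: 1 + \sum_j rdiv j f * ncvar j.
Proof.
apply/funext => w; rewrite ncseriesDE ncseriesZE ncsumE.
case/lastP: w => [|w i].
  rewrite -ncmono1 /ncmono eqxx mulr1 big1 ?addr0 // => j _.
  exact: ncmul_var_nil.
rewrite -ncmono1 /ncmono -size_eq0 size_rcons mulr0 add0r.
rewrite (bigD1 i) //= ncmul_var eqxx mulr1 big1 ?addr0 // => j neq.
by rewrite ncmul_var eq_sym (negPf neq) mulr0.
Qed.

Lemma rdiv_sum_var i (b : 'I_d -> S) : rdiv i (\sum_j b j * ncvar j) = b i.
Proof.
apply/funext => w; rewrite /rdiv ncsumE (bigD1 i) //= ncmul_var eqxx mulr1.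
rewrite big1 ?addr0 // => j neq.
by rewrite ncmul_var eq_sym (negPf neq) mulr0.
Qed.

Lemma rdivD i f g : rdiv i (f + g) = rdiv i f + rdiv i g. Proof. by []. Qed.
Lemma rdivZ i c f : rdiv i (c *: f) = c *: rdiv i f. Proof. by []. Qed.

Lemma rdiv1 i : rdiv i 1 = 0.
Proof.
by apply/funext => w; rewrite /rdiv -ncmono1 /ncmono -size_eq0 size_rcons.
Qed.

Lemma ord_geD n f g : ord_ge n f -> ord_ge n g -> ord_ge n (f + g).
Proof. by move=> Hf Hg w lt; rewrite ncseriesDE Hf // Hg // addr0. Qed.

Lemma ord_geZ n c f : ord_ge n f -> ord_ge n (c *: f).
Proof. by move=> Hf w lt; rewrite ncseriesZE Hf // mulr0. Qed.

Lemma ord_geB n f g : ord_ge n f -> ord_ge n g -> ord_ge n (f - g).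
Proof. by move=> Hf Hg; rewrite -scaleN1r; apply/ord_geD/ord_geZ. Qed.

Lemma ord_ge_sum n (I : finType) (F : I -> S) :
  (forall x, ord_ge n (F x)) -> ord_ge n (\sum_x F x).
Proof. by move=> H; elim/big_ind: _ => //; exact: ord_geD. Qed.

Lemma ord_geW m n f : (m <= n)%N -> ord_ge n f -> ord_ge m f.
Proof. by move=> le Hf w lt; apply: Hf; exact: leq_trans lt le. Qed.

Lemma ord_geM m n f g : ord_ge m f -> ord_ge n g -> ord_ge (m + n) (f * g).
Proof.
move=> Hf Hg w lt; rewrite ncmulE big1 // => l _.
have le : (l <= size w)%N by rewrite -ltnS.
case: (ltnP l m) => lm.
  by rewrite Hf ?mul0r // size_takel.
by rewrite Hg ?mulr0 // size_drop; lia.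
Qed.

Lemma ord_ge_rdiv n i f : ord_ge n.+1 f -> ord_ge n (rdiv i f).
Proof. by move=> Hf w lt; apply: Hf; rewrite size_rcons. Qed.

Lemma ord_ge_var i : ord_ge 1 (ncvar i).
Proof. by case. Qed.

Lemma ord_ge_mono w : ord_ge (size w) (ncmono K w).
Proof.
by move=> v lt; rewrite /ncmono; case: eqP => // E; rewrite E ltnn in lt.
Qed.

Lemma has_order_ord_ge f k : has_order f k -> ord_ge k f.
Proof.
move=> [_ H] w lt; have /(congr1 (fun g : S => g w)) := H _ lt.
by rewrite /nc_hom eqxx.
Qed.

Lemma ideal_exp_nc_max n : ideal_exp (@nc_max K d) n `<=` ord_ge n.
Proof.
elim: n => [|n IHn] f //= [m [a [b [Ha Hb ->]]]].
apply: ord_ge_sum => i; rewrite -addn1 addnC; apply: ord_geM; last exact/IHn/Hb.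
by move=> [|//] _; exact: Ha.
Qed.

(** The coefficient of [w] in the sum of all rotations of [f]. *)
Definition cyc f w : K := \sum_(m < size w) f (rot m w).

Lemma sum_rot_mono (T : finType) n (F : seq T -> K) (v : seq T) :
  size v = n.+1 ->
  \sum_(w : n.+1.-tuple T) F w * \sum_(m < n.+1) (rot m w == v)%:R =
  \sum_(m < n.+1) F (rotr m v).
Proof.
move=> sv; under eq_bigr do rewrite mulr_sumr.
rewrite exchange_big /=; apply: eq_bigr => m _.
have sr : size (rotr m v) == n.+1 by rewrite size_rotr sv.
rewrite (bigD1 (Tuple sr)) //= rotrK eqxx mulr1 big1 ?addr0 // => w neq.
case: eqP => [E|]; last by rewrite mulr0.
by case/eqP: neq; apply/val_inj; rewrite /= -E rotK.
Qed.

Lemma cder_word_rot i w u :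
  cder_word K i w u = \sum_(m < size w) (rot m w == i :: u)%:R.
Proof.
rewrite /cder_word ncsumE big_mkcond /=; apply: eq_bigr => m _.
rewrite (tnth_nth i) /= /rot [in RHS](drop_nth i) // cat_cons eqseq_cons.
by rewrite /ncmono [u == _]eq_sym; case: eqP.
Qed.

(** Deleting an occurrence of [x_i] in [w] and reading on cyclically gives [u]
exactly when the corresponding rotation of [w] is [i :: u]. *)
Lemma cderE i f u : cder i f u = cyc f (i :: u).
Proof.
rewrite /cder /cyc.
transitivity (\sum_(w : (size u).+1.-tuple 'I_d)
    f w * \sum_(m < (size u).+1) (rot m w == i :: u)%:R).
  apply: eq_bigr => w _; congr (_ * _); rewrite cder_word_rot.
  rewrite -(big_mkord xpredT (fun m => (rot m w == i :: u)%:R)).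
  by rewrite size_tuple big_mkord.
rewrite sum_rot_mono // (reindex_inj rev_ord_inj) /=.
rewrite big_ord_recr [RHS]big_ord_recl /= addrC; congr (_ + _).
  by rewrite subnn /rotr subn0 rot_size rot0.
apply: eq_bigr => m _; rewrite /bump /= /rotr /=; congr (f (rot _ _)).
by have := ltn_ord m; lia.
Qed.

Lemma cyc_rot1 f i u : cyc f (rcons u i) = cyc f (i :: u).
Proof.
have E m : (m <= size u)%N -> rot m (rcons u i) = rot m.+1 (i :: u).
  by move=> le; rewrite -rot1_cons -rotD ?addn1.
rewrite /cyc size_rcons /= big_ord_recr big_ord_recl /= addrC; congr (_ + _).
  by rewrite E // rot0 -[(size u).+1]/(size (i :: u)) rot_size.
by apply: eq_bigr => m _; rewrite E // ltnW.
Qed.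

(** Both sides are the sum of all rotations of [f]. *)
Lemma euler_cder f :
  \sum_i ncvar i * cder i f = \sum_i cder i f * ncvar i.
Proof.
apply/funext => w; rewrite !ncsumE.
case: w => [|i u].
  by rewrite !big1 // => i _; rewrite ?ncmul_var_nil ?ncvar_mul_nil.
rewrite (bigD1 i) //= ncvar_mul eqxx mul1r big1 ?addr0; last first.
  by move=> j neq; rewrite ncvar_mul eq_sym (negPf neq) mul0r.
rewrite cderE; have [v [j ->]] : exists v j, i :: u = rcons v j.
  by rewrite lastI; exists (belast i u), (last i u).
rewrite (bigD1 j) //= ncmul_var eqxx mulr1 big1 ?addr0; last first.
  by move=> l neq; rewrite ncmul_var eq_sym (negPf neq) mulr0.
by rewrite cderE cyc_rot1.
Qed.

Lemma cderD i f g : cder i (f + g) = cder i f + cder i g.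
Proof.
apply/funext => u; rewrite ncseriesDE !cderE -big_split.
by apply: eq_bigr => m _.
Qed.

Lemma cderZ i c f : cder i (c *: f) = c *: cder i f.
Proof.
apply/funext => u; rewrite ncseriesZE !cderE mulr_sumr.
by apply: eq_bigr => m _.
Qed.

Lemma ord_ge_cder n i f : ord_ge n f -> ord_ge n.-1 (cder i f).
Proof.
move=> Hf u lt; rewrite cderE /cyc big1 // => m _.
by apply: Hf; rewrite size_rot /=; lia.
Qed.

End Series.

Arguments omega : clear implicits.

(** * Jets and their ranks *)

Section Rank.
Variables (K : fieldType) (d : nat).
Local Notation S := (ncseries K d).
Local Notation word := (seq 'I_d).
Implicit Types (f g h : S) (u v w : word) (X : set S).

(** The words of length less than [n]; they index the coordinates of jets. *)
Fixpoint words n : seq word :=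
  if n is n'.+1 then
    [::] :: [seq rcons w i | w <- words n', i <- enum 'I_d]
  else [::].

Definition nwords n := size (words n).

Definition jet n f : 'rV[K]_(nwords n) :=
  \row_l f (nth [::] (words n) l).

Definition tmx n r (s : 'I_r -> S) : 'M[K]_(r, nwords n) :=
  \matrix_l jet n (s l).

Lemma nwordsS n : nwords n.+1 = (d * nwords n).+1.
Proof. by rewrite /nwords /= size_allpairs size_enum_ord mulnC. Qed.

Lemma mem_words n w : (w \in words n) = (size w < n)%N.
Proof.
elim: n w => [|n IHn] w //=; rewrite in_cons.
case/lastP: w => [|w i] //; rewrite size_rcons ltnS -IHn.
have -> : (rcons w i == [::]) = false by rewrite -size_eq0 size_rcons.
apply/allpairsP/idP => [[[v j] [/= Hv _ E]]|Hw].
  by move/rcons_inj: E => [-> _].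
by exists (w, i); rewrite mem_enum.
Qed.

Lemma words_uniq n : uniq (words n).
Proof.
elim: n => //= n IHn; apply/andP; split.
  apply/allpairsP => -[[v j] [_ _ /= /(congr1 size)]].
  by rewrite size_rcons.
apply: allpairs_uniq => //; first exact: enum_uniq.
by move=> [u i] [v j] _ _ /= /rcons_inj [-> ->].
Qed.

Lemma jetD n f g : jet n (f + g) = jet n f + jet n g.
Proof. by apply/rowP => l; rewrite !mxE. Qed.

Lemma jetZ n c f : jet n (c *: f) = c *: jet n f.
Proof. by apply/rowP => l; rewrite !mxE. Qed.

Lemma jet_sum n (I : finType) (F : I -> S) :
  jet n (\sum_x F x) = \sum_x jet n (F x).
Proof.
elim/big_ind2: _ => [|f v g u <- <-|//]; last by rewrite jetD.
by apply/rowP => l; rewrite !mxE.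
Qed.

Lemma jet_eq0 n f : jet n f = 0 <-> ord_ge n f.
Proof.
split => [E w lt|Hf]; last first.
  by apply/rowP => l; rewrite !mxE Hf // -mem_words mem_nth.
have Hw : w \in words n by rewrite mem_words.
have lt' : (index w (words n) < nwords n)%N by rewrite index_mem.
by move/rowP: E => /(_ (Ordinal lt')); rewrite !mxE /= nth_index.
Qed.

Lemma jet_eq n f g : ord_ge n (f - g) -> jet n f = jet n g.
Proof.
move/jet_eq0; rewrite -scaleN1r jetD jetZ scaleN1r => /eqP.
by rewrite subr_eq0 => /eqP.
Qed.

Lemma jet_mono n (l : 'I_(nwords n)) :
  jet n (ncmono K (nth [::] (words n) l)) = delta_mx 0 l.
Proof.
by apply/rowP => m; rewrite !mxE /ncmono nth_uniq ?words_uniq.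
Qed.

Lemma jet_surj n (v : 'rV_(nwords n)) : exists f, jet n f = v.
Proof.
exists (\sum_l v 0 l *: ncmono K (nth [::] (words n) l)).
rewrite jet_sum [RHS]row_sum_delta.
by apply: eq_bigr => l _; rewrite jetZ jet_mono.
Qed.

Lemma tmx_mul n r (c : 'rV_r) (s : 'I_r -> S) :
  c *m tmx n s = jet n (\sum_l c 0 l *: s l).
Proof.
rewrite mulmx_sum_row jet_sum; apply: eq_bigr => l _.
by rewrite jetZ rowK.
Qed.

Lemma jet_sub_tmx n r (s : 'I_r -> S) f : (jet n f <= tmx n s)%MS ->
  exists c : 'I_r -> K, ord_ge n (f - \sum_l c l *: s l).
Proof.
move=> /submxP[c]; rewrite tmx_mul => E; exists (fun l => c 0 l).
apply/jet_eq0; rewrite -scaleN1r jetD jetZ scaleN1r E.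
exact: subrr.
Qed.

(** A family of maximal size among those in [X] with independent jets. *)
Lemma ex_jet_basis n X : exists r (s : 'I_r -> S),
  [/\ forall l, X (s l), row_free (tmx n s)
    & forall f, X f -> (jet n f <= tmx n s)%MS].
Proof.
pose P r := `[< exists s : 'I_r -> S,
  (forall l, X (s l)) /\ row_free (tmx n s) >].
have P0 : exists r, P r.
  exists 0; apply/asboolP; exists (fun=> 0); split; first by case.
  by rewrite -row_leq_rank.
have Pmax r : P r -> (r <= nwords n)%N.
  move=> /asboolP[s [_ /eqP <-]]; exact: rank_leq_col.
case: (ex_maxnP P0 Pmax) => r /asboolP[s [Xs free_s]] maxr.
exists r, s; split=> // f Xf; apply: contraT => nsub.
have : (r.+1 <= r)%N.
  apply: maxr; apply/asboolP.
  exists (fun l => if unlift ord0 l is Some m then s m else f); split.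
    by move=> l; case: unliftP.
  rewrite -row_leq_rank; set M := tmx n _.
  have lt : (tmx n s < jet n f + tmx n s)%MS.
    rewrite ltmxE addsmxSr /=; apply: contra nsub.
    exact/submx_trans/addsmxSl.
  have le : (jet n f + tmx n s <= M)%MS.
    rewrite addsmx_sub; apply/andP; split.
      by apply: (eq_row_sub ord0); rewrite rowK unlift_none.
    apply/row_subP => l; rewrite rowK.
    by apply: (eq_row_sub (lift ord0 l)); rewrite rowK liftK.
  rewrite -{1}(eqP free_s).
  exact: leq_trans (rank_ltmx lt) (mxrankS le).
by rewrite ltnn.
Qed.

(** The dimension of the span of the image of [X] in the series modulo order
[n]. *)
Definition jrank n X : nat := sval (cid (ex_jet_basis n X)).
Definition jet_basis n X : 'I_(jrank n X) -> S :=
  sval (cid (svalP (cid (ex_jet_basis n X)))).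
Arguments jet_basis : clear implicits.

Lemma jet_basisP n X : [/\ forall l, X (jet_basis n X l),
    row_free (tmx n (jet_basis n X))
  & forall f, X f -> (jet n f <= tmx n (jet_basis n X))%MS].
Proof. exact: svalP (cid (svalP (cid (ex_jet_basis n X)))). Qed.

Lemma jrank_basis n X : \rank (tmx n (jet_basis n X)) = jrank n X.
Proof. by have [_ /eqP] := jet_basisP n X. Qed.

Lemma jrank_le n X r (U : 'M[K]_(r, nwords n)) :
  (forall f, X f -> (jet n f <= U)%MS) -> (jrank n X <= \rank U)%N.
Proof.
move=> H; have [HX _ _] := jet_basisP n X; rewrite -jrank_basis; apply: mxrankS.
by apply/row_subP => l; rewrite rowK; exact: H.
Qed.

Lemma jrank_ge n X r (s : 'I_r -> S) :
  (forall l, X (s l)) -> (\rank (tmx n s) <= jrank n X)%N.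
Proof.
move=> H; have [_ _ HX] := jet_basisP n X; rewrite -jrank_basis; apply: mxrankS.
by apply/row_subP => l; rewrite rowK; exact: HX.
Qed.

Lemma jrank_nwords n X : (jrank n X <= nwords n)%N.
Proof. by rewrite -jrank_basis; exact: rank_leq_col. Qed.

Lemma ex_jet_complement n X : exists h : 'I_(nwords n - jrank n X) -> S,
  row_free (tmx n h) /\
  (((tmx n (jet_basis n X))^C)%MS == tmx n h)%MS.
Proof.
set C := ((tmx n (jet_basis n X))^C)%MS.
have rC : \rank C = (nwords n - jrank n X)%N.
  by rewrite mxrank_compl jrank_basis.
rewrite -rC; have [h Hh] := choice (fun l => jet_surj (row l (row_base C))).
exists h; have -> : tmx n h = row_base C.
  by apply/row_matrixP => l; rewrite rowK Hh.
by split; [exact: row_base_free | apply/eqmxP/eqmx_sym/eq_row_base].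
Qed.

(** Deform a basis at [t = 0] to a matrix affine in [t], and multiply it by a
right inverse [C] of its value at [0]: the determinant of the product is a
polynomial in [t] with value 1 at [0], and the deformed family stays independent
where it does not vanish. *)
Lemma jrank_deform n (X : K -> set S) :
  (forall f, X 0 f -> exists g, forall t, X t (f + t *: g)) ->
  exists2 q : {poly K}, q != 0 &
    forall t, q.[t] != 0 -> (jrank n (X 0%R) <= jrank n (X t))%N.
Proof.
move=> H; have [Xs free_s _] := jet_basisP n (X 0).
have [g Hg] := choice (fun l => H _ (Xs l)).
set A := tmx n _ in free_s; have [C AC] := row_freeP free_s.
pose B := tmx n g.
pose q : {poly K} :=
  \det (map_mx polyC (A *m C) + 'X *: map_mx polyC (B *m C)).
have qE t : q.[t] = \det ((A + t *: B) *m C).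
  rewrite -horner_evalE -det_map_mx; congr (\det _).
  apply/matrixP => i j; rewrite mulmxDl -scalemxAl.
  by rewrite !mxE /= horner_evalE hornerD hornerM hornerX !hornerC.
exists q => [|t].
  apply: contraTneq (oner_neq0 K) => q0.
  by rewrite -(det1 K (jrank n (X 0%R))) -AC -[A]addr0 -(scale0r B) -qE q0
    horner0 eqxx.
rewrite qE => qt; have free_t : row_free (A + t *: B).
  have : (A + t *: B) *m C \in unitmx by rewrite unitmxE unitfE.
  rewrite -row_free_unit => /eqP E; rewrite /row_free eqn_leq rank_leq_row /=.
  by apply: leq_trans (mxrankM_maxl _ C); rewrite E.
apply: (leq_trans (eq_leq (esym (eqP free_t)))).
have -> : A + t *: B = tmx n (fun l => jet_basis n (X 0) l + t *: g l).
  by rewrite /A /B /tmx; apply/matrixP => l m; rewrite !mxE.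
exact: jrank_ge.
Qed.

End Rank.

Arguments jet_basis {K d} n X l.

(** * Two-sided ideals *)

Section IdealClosure.
Variables (K : comNzRingType) (A : algType K) (I : set A).
Hypothesis idI : is_ideal I.

Lemma is_ideal0 : I 0. Proof. by have [[]] := idI. Qed.

Lemma is_idealB x y : I x -> I y -> I (x - y).
Proof. by have [[_ IB _] _] := idI; exact: IB. Qed.

Lemma is_idealD x y : I x -> I y -> I (x + y).
Proof.
move=> Ix Iy; rewrite -[y]opprK; apply: is_idealB => //.
by rewrite -sub0r; apply: is_idealB => //; exact: is_ideal0.
Qed.

Lemma is_idealMl a x : I x -> I (a * x).
Proof. by have [[_ _ Il] _] := idI; exact: Il. Qed.

Lemma is_idealMr a x : I x -> I (x * a).
Proof. by have [_ Ir] := idI; exact: Ir. Qed.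

Lemma is_idealZ c x : I x -> I (c *: x).
Proof. by move=> Ix; rewrite -[x]mul1r scalerAl; exact: is_idealMl. Qed.

Lemma is_ideal_sum (J : finType) (F : J -> A) :
  (forall x, I (F x)) -> I (\sum_x F x).
Proof.
by move=> H; elim/big_ind: _ => //; [exact: is_ideal0 | exact: is_idealD].
Qed.

End IdealClosure.

Lemma sub_ideal_gen (A : pzRingType) (X : set A) : X `<=` ideal_gen X.
Proof. by move=> x Xx I [_ XI]; exact: XI. Qed.


(** * The recursion for the Jacobian ideal *)

Section Jacobian.
Variables (K : fieldType) (d : nat).
Local Notation S := (ncseries K d).
Local Notation word := (seq 'I_d).
Implicit Types (f g h : S) (u v w : word) (X : set S).

(** The ideal without the closure: both have the same jets, as
[jac_ideal_jgen] shows. *)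
Definition jgen f : set S := ideal_gen [set g | exists i, g = cder i f].

(** The subspace L of the introduction.  The scalars correspond to nothing in
F^d; with them, [jsyz f] lives in F itself, and its corank in jets of order
[q.+1] is the codimension of L in the [d]-tuples of jets of order [q]. *)
Definition jsyz f : set S :=
  [set g | exists c b (y : 'I_d -> S), (forall j, jgen f (y j)) /\
     g = c *: 1 + b * omega K d + \sum_j y j * ncvar K j].

(** The map (b_i) |-> sum b_i delta_i f, read on [h], the sum of the b_i x_i:
the last letter [x_i] of each word is replaced by the [i]-th derivative. *)
Definition subst_last f h : S := \sum_i rdiv i h * cder i f.

Lemma is_ideal_jgen f : is_ideal (jgen f). Proof. exact: is_ideal_gen. Qed.

Lemma cder_jgen i f : jgen f (cder i f).
Proof. by apply: sub_ideal_gen; exists i. Qed.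

Lemma jgen_ord_ge k f : ord_ge k f -> jgen f `<=` ord_ge k.-1.
Proof.
move=> Hf g; apply; split; last by move=> _ [i ->]; exact: ord_ge_cder.
split; first split => //.
- exact: ord_geB.
- by move=> a x Hx; rewrite -[k.-1]add0n; apply: ord_geM.
- by move=> a x Hx; rewrite -[k.-1]addn0; apply: ord_geM.
Qed.

(** In a product b (delta_i f) a, write [a] as its constant term plus a sum of
multiples a_j x_j: all terms but the first end with a variable and have their
other factor in the ideal. *)
Lemma jgen_decomp f g : jgen f g -> exists h (y : 'I_d -> S),
  (forall j, jgen f (y j)) /\ g = subst_last f h + \sum_j y j * ncvar K j.
Proof.
move=> Hg; have id := is_ideal_jgen f.
suff [b [y [Hy ->]]] : exists b y : 'I_d -> S, (forall j, jgen f (y j)) /\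
    g = \sum_i b i * cder i f + \sum_j y j * ncvar K j.
  exists (\sum_j b j * ncvar K j), y; split=> //; congr (_ + _).
  by apply: eq_bigr => i _; rewrite rdiv_sum_var.
pose X := [set g | jgen f g /\ exists b y : 'I_d -> S,
  (forall j, jgen f (y j)) /\
    g = \sum_i b i * cder i f + \sum_j y j * ncvar K j].
suff : X g by case.
apply: Hg; split; last first.
  move=> _ [i ->]; split; first exact: cder_jgen.
  exists (fun j => (j == i)%:R), (fun=> 0); split.
    by move=> _; exact: (is_ideal0 id).
  rewrite [X in _ + X]big1 ?addr0 => [|j _]; last exact: mul0r.
  rewrite (bigD1 i) //= eqxx mul1r big1 ?addr0 // => j /negPf ->.
  exact: mul0r.
split; first split.
- split; first exact: (is_ideal0 id).
  exists (fun=> 0), (fun=> 0); split=> [_|]; first exact: (is_ideal0 id).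
  by rewrite !big1 ?addr0 // => i _; rewrite mul0r.
- move=> x x' [Hx [b [y [Hy E]]]] [Hx' [b' [y' [Hy' E']]]].
  split; first exact: (is_idealB id).
  exists (fun i => b i - b' i), (fun i => y i - y' i).
  split=> [j|]; first exact: (is_idealB id).
  by rewrite E E' opprD addrACA -!sumrB; congr (_ + _);
    apply: eq_bigr => i _; rewrite mulrBl.
- move=> a x [Hx [b [y [Hy E]]]]; split; first exact: (is_idealMl id).
  exists (fun i => a * b i), (fun i => a * y i).
  split=> [j|]; first exact: (is_idealMl id).
  by rewrite E mulrDr !mulr_sumr; congr (_ + _); apply: eq_bigr => j _;
    rewrite mulrA.
- move=> a x [Hx [b [y [Hy E]]]]; split; first exact: (is_idealMr id).
  exists (fun i => a [::] *: b i), (fun i => a [::] *: y i + x * rdiv i a).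
  split=> [j|].
    apply: (is_idealD id); first exact: (is_idealZ id).
    exact: (is_idealMr id).
  rewrite [a in LHS]rdivE mulrDr -scalerAr mulr1 {1}E.
  rewrite scalerDr !scaler_sumr mulr_sumr -addrA -big_split /=.
  congr (_ + _); first by apply: eq_bigr => i _; rewrite scalerAl.
  by apply: eq_bigr => i _; rewrite mulrDl scalerAl mulrA.
Qed.

Lemma subst_lastD f g h :
  subst_last f (g + h) = subst_last f g + subst_last f h.
Proof. by rewrite -big_split; apply: eq_bigr => i _; rewrite rdivD mulrDl. Qed.

Lemma subst_lastZ f c h : subst_last f (c *: h) = c *: subst_last f h.
Proof.
by rewrite scaler_sumr; apply: eq_bigr => i _; rewrite rdivZ scalerAl.
Qed.

Lemma subst_lastB f g h :
  subst_last f (g - h) = subst_last f g - subst_last f h.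
Proof. by rewrite -scaleN1r subst_lastD subst_lastZ scaleN1r. Qed.

Lemma subst_last_comb f r (c : 'I_r -> K) (s : 'I_r -> S) :
  subst_last f (\sum_l c l *: s l) = \sum_l c l *: subst_last f (s l).
Proof.
elim/big_rec2: _ => [|l g h _ <-]; last by rewrite subst_lastD subst_lastZ.
by rewrite /subst_last big1 // => i _; exact: mul0r.
Qed.

Lemma ord_ge_subst_last k q f h :
  ord_ge k f -> ord_ge q.+1 h -> ord_ge (q + k.-1) (subst_last f h).
Proof.
move=> Hf Hh; apply: ord_ge_sum => i; apply: ord_geM.
  exact: ord_ge_rdiv.
exact: ord_ge_cder.
Qed.

(** On the multiples of [omega] this is [euler_cder]: the sum of the
b x_i (delta_i f) is the sum of the b (delta_i f) x_i. *)
Lemma subst_last_jsyz f g : ord_ge 2 f -> jsyz f g ->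
  exists y : 'I_d -> S, (forall j, jgen f (y j)) /\
    subst_last f g = \sum_j y j * ncvar K j.
Proof.
move=> Hf [c [b [y [Hy ->]]]]; have id := is_ideal_jgen f.
exists (fun j => b * cder j f + \sum_i y i * rdiv j (cder i f)).
split=> [j|].
  apply: (is_idealD id); first by apply: (is_idealMl id); exact: cder_jgen.
  by apply: (is_ideal_sum id) => // i; apply: (is_idealMr id).
rewrite !subst_lastD subst_lastZ.
have -> : subst_last f 1 = 0.
  by rewrite /subst_last big1 // => i _; rewrite rdiv1 mul0r.
rewrite scaler0 add0r.
have -> : subst_last f (b * omega K d) = b * \sum_i ncvar K i * cder i f.
  rewrite /omega mulr_sumr; under eq_bigr do rewrite mulrA.
  rewrite mulr_sumr; apply: eq_bigr => i _.
  by rewrite rdiv_sum_var mulrA.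
rewrite euler_cder mulr_sumr.
under [RHS]eq_bigr do rewrite mulrDl.
rewrite big_split /=; congr (_ + _).
  by apply: eq_bigr => j _; rewrite mulrA.
under [RHS]eq_bigr do rewrite mulr_suml.
rewrite exchange_big /=; apply: eq_bigr => i _; rewrite rdiv_sum_var.
rewrite {1}[cder i f]rdivE (ord_ge_cder i Hf) // scale0r add0r mulr_sumr.
by apply: eq_bigr => j _; rewrite mulrA.
Qed.

Lemma jet_comb_sub n r (c : 'I_r -> K) (s : 'I_r -> S) :
  (jet n (\sum_l c l *: s l)%R <= tmx n s)%MS.
Proof.
rewrite jet_sum; apply: summx_sub => l _; rewrite jetZ.
by apply: scalemx_sub; apply: (eq_row_sub l); rewrite rowK.
Qed.

Lemma jet_compl n X : exists h : 'I_(nwords d n - jrank n X) -> S,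
  forall g, exists c c',
    ord_ge n (g - (\sum_l c l *: jet_basis n X l + \sum_l c' l *: h l)).
Proof.
have [h [_ /eqmxP eqh]] := ex_jet_complement n X; exists h => g.
have : (jet n g <= tmx n (jet_basis n X) + tmx n h)%MS.
  rewrite -(adds_eqmx (eqmx_refl _) eqh).
  by apply: submx_full; exact: addsmx_compl_full.
case/sub_addsmxP => -[u v] /= E; exists (fun l => u 0 l), (fun l => v 0 l).
apply/jet_eq0; rewrite -scaleN1r jetD jetZ scaleN1r jetD.
by rewrite -!tmx_mul E subrr.
Qed.

(** If the span of [X] and the rows of [U] contain all monomials, the latter
make up for the codimension of [X]. *)
Lemma corank_le n X r (U : 'M[K]_(r, nwords d n)) :
  (forall w, (size w < n)%N ->
     (jet n (ncmono K w) <= tmx n (jet_basis n X) + U)%MS) ->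
  (nwords d n - jrank n X <= \rank U)%N.
Proof.
move=> H; rewrite leq_subLR -jrank_basis.
apply: leq_trans _ (mxrank_adds_leqif _ _).1.
rewrite -{1}(mxrank1 K (nwords d n)); apply: mxrankS.
apply/row_subP => l; rewrite rowE mulmx1 -jet_mono; apply: H.
by rewrite -mem_words mem_nth.
Qed.

Lemma mxrank_sum_le (F : fieldType) (J : finType) m n (Y : J -> 'M[F]_(m, n)) :
  (\rank (\sum_j <<Y j>>)%MS <= #|J| * m)%N.
Proof.
apply: leq_trans (mxrank_sum_leqif _).1 _; rewrite -sum_nat_const.
by apply: leq_sum => j _ /=; rewrite genmxE; exact: rank_leq_row.
Qed.

(** By [jgen_decomp] the ideal is spanned, modulo order [n.+1], by the
multiples [s * x_j] for [s] in a basis modulo order [n], and by the values of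
[subst_last f]; by [subst_last_jsyz] it is enough to take these on a complement
of [jsyz f].  As the derivatives have order at least [k.-1], that complement is
only needed modulo order [q.+1]. *)
Lemma jrank_jgenS k n q f : (2 <= k)%N -> (n.+2 <= q + k)%N -> ord_ge k f ->
  (jrank n.+1 (jgen f) <=
     d * jrank n (jgen f) + (nwords d q.+1 - jrank q.+1 (jsyz f)))%N.
Proof.
move=> k2 leq Hf; have Hf2 := ord_geW k2 Hf.
have [h Hh] := jet_compl q.+1 (jsyz f).
pose s := jet_basis n (jgen f).
pose Y j := tmx n.+1 (fun l => s l * ncvar K j).
pose N := tmx n.+1 (fun l => subst_last f (h l)).
apply: (@leq_trans (\rank (\sum_j <<Y j>> + N)%MS)); last first.
  apply: leq_trans (mxrank_adds_leqif _ _).1 _; apply: leq_add.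
    by rewrite -[X in (_ <= X * _)%N]card_ord; exact: mxrank_sum_le.
  exact: rank_leq_row.
have HM y : (forall j, jgen f (y j)) ->
    (jet n.+1 (\sum_j y j * ncvar K j)%R <= \sum_j <<Y j>> + N)%MS.
  move=> Hy; apply: submx_trans (addsmxSl _ _); rewrite jet_sum.
  apply: summx_sub => j _; apply: (sumsmx_sup j) => //; rewrite genmxE.
  have [_ _ /(_ _ (Hy j)) /jet_sub_tmx [c Hc]] := jet_basisP n (jgen f).
  have -> : jet n.+1 (y j * ncvar K j) =
      jet n.+1 (\sum_l c l *: (s l * ncvar K j)).
    apply: jet_eq; under eq_bigr do rewrite scalerAl.
    rewrite -mulr_suml -mulrBl -addn1; apply: ord_geM => //.
    exact: ord_ge_var.
  exact: jet_comb_sub.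
apply: jrank_le => g /jgen_decomp[h' [y [Hy ->]]].
rewrite jetD; apply: addmx_sub; last exact: HM.
have [c [c' Hc]] := Hh h'.
have -> : jet n.+1 (subst_last f h') = jet n.+1
    (\sum_l c l *: subst_last f (jet_basis q.+1 (jsyz f) l) +
     \sum_l c' l *: subst_last f (h l)).
  apply: jet_eq; rewrite -!subst_last_comb -subst_lastD -subst_lastB.
  by apply: ord_geW (ord_ge_subst_last Hf Hc); lia.
rewrite jetD; apply: addmx_sub; last first.
  by apply: submx_trans (addsmxSr _ _); exact: jet_comb_sub.
rewrite jet_sum; apply: summx_sub => l _; rewrite jetZ.
apply: scalemx_sub; have [Hl _ _] := jet_basisP q.+1 (jsyz f).
by have [y' [Hy' ->]] := subst_last_jsyz Hf2 (Hl l); exact: HM.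
Qed.

(** The crude bound that only uses the multiples [y * x_j] with [y] in the
ideal. *)
Lemma corank_jsyz q f :
  (nwords d q.+1 - jrank q.+1 (jsyz f) <=
     d * (nwords d q - jrank q (jgen f)))%N.
Proof.
have [h Hh] := jet_compl q (jgen f).
pose Y j := tmx q.+1 (fun l => h l * ncvar K j).
have HM : (\rank (\sum_j <<Y j>>)%MS <= d * (nwords d q - jrank q (jgen f)))%N.
  by rewrite -[X in (_ <= X * _)%N]card_ord; exact: mxrank_sum_le.
apply: leq_trans HM; apply: corank_le => w _; set g := ncmono K w.
have [c Hc] := choice (fun j => Hh (rdiv j g)).
have [c' Hc'] := choice Hc.
pose y j := \sum_l c j l *: jet_basis q (jgen f) l.
have [Hb _ _] := jet_basisP q (jgen f).
have [_ _ HL] := jet_basisP q.+1 (jsyz f).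
have -> : jet q.+1 g = jet q.+1
   ((g [::] *: 1 + 0 * omega K d + \sum_j y j * ncvar K j) +
     \sum_j \sum_l c' j l *: (h l * ncvar K j)).
  apply: jet_eq; rewrite mul0r addr0 {1}[g]rdivE -[X in _ - X]addrA opprD.
  rewrite addrACA subrr add0r -big_split -sumrB /=; apply: ord_ge_sum => j.
  under [X in _ - (_ + X)]eq_bigr do rewrite scalerAl.
  rewrite -mulr_suml -mulrDl -mulrBl -addn1; apply: ord_geM => //.
  exact: ord_ge_var.
rewrite jetD; apply: addmx_sub.
  apply: submx_trans (addsmxSl _ _); apply: HL.
  exists (g [::]), 0, y; split=> // j.
  have id := is_ideal_jgen f.
  by apply: (is_ideal_sum id) => l; exact: (is_idealZ id).
apply: submx_trans (addsmxSr _ _); rewrite jet_sum; apply: summx_sub => j _.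
by apply: (sumsmx_sup j) => //; rewrite genmxE; exact: jet_comb_sub.
Qed.

End Jacobian.

(** * Deformation along a line of potentials *)

Section Deformation.
Variables (K : fieldType) (d : nat).
Local Notation S := (ncseries K d).
Implicit Types (f g h : S).

(** Replace [f] by [f + t *: h] in an expression of [g] by the derivatives of
[f]: it is affine in [t], because the derivatives are. *)
Lemma jgen_deform f h g : jgen f g ->
  exists g', forall t, jgen (f + t *: h) (g + t *: g').
Proof.
move=> /(_ [set x | exists x', forall t, jgen (f + t *: h) (x + t *: x')]).
apply; split; last first.
  by move=> _ [i ->]; exists (cder i h) => t; rewrite -cderZ -cderD;
    exact: cder_jgen.
have id t := is_ideal_jgen (f + t *: h).
split; first split.
- by exists 0 => t; rewrite scaler0 addr0; exact: (is_ideal0 (id t)).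
- move=> x y [x' Hx] [y' Hy]; exists (x' - y') => t.
  by rewrite scalerBr addrACA -opprD; exact: (is_idealB (id t)).
- move=> a x [x' Hx]; exists (a * x') => t.
  by rewrite scalerAr -mulrDr; exact: (is_idealMl (id t)).
- move=> a x [x' Hx]; exists (x' * a) => t.
  by rewrite scalerAl -mulrDl; exact: (is_idealMr (id t)).
Qed.

Lemma jsyz_deform f h g : jsyz f g ->
  exists g', forall t, jsyz (f + t *: h) (g + t *: g').
Proof.
move=> [c [b [y [Hy ->]]]].
have [y' Hy'] := choice (fun j => jgen_deform h (Hy j)).
exists (\sum_j y' j * ncvar K j) => t; exists c, b, (fun j => y j + t *: y' j).
split=> [j|]; first exact: Hy'.
rewrite -addrA scaler_sumr -big_split; congr (_ + _).
by apply: eq_bigr => j _; rewrite mulrDl scalerAl.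
Qed.

Lemma jrank_jgen_generic n f h : exists2 q : {poly K}, q != 0 &
  forall t, q.[t] != 0 ->
    (jrank n (jgen f) <= jrank n (jgen (f + t *: h)%R))%N.
Proof.
have [g|q q0 Hq] := @jrank_deform K d n (fun t => jgen (f + t *: h)).
  by rewrite scale0r addr0; exact: jgen_deform.
by exists q => // t /Hq; rewrite scale0r addr0.
Qed.

Lemma jrank_jsyz_generic n f h : exists2 q : {poly K}, q != 0 &
  forall t, q.[t] != 0 ->
    (jrank n (jsyz f) <= jrank n (jsyz (f + t *: h)%R))%N.
Proof.
have [g|q q0 Hq] := @jrank_deform K d n (fun t => jsyz (f + t *: h)).
  by rewrite scale0r addr0; exact: jsyz_deform.
by exists q => // t /Hq; rewrite scale0r addr0.
Qed.

Definition jdim n f : nat := (nwords d n - jrank n (jgen f))%N.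

Lemma jdimS k n q f : (2 <= k)%N -> (n.+2 <= q + k)%N -> ord_ge k f ->
  (d * jdim n f < jdim n.+1 f + (nwords d q.+1 - jrank q.+1 (jsyz f)))%N.
Proof.
move=> k2 leq Hf; have := jrank_jgenS k2 leq Hf.
have := jrank_nwords n (jgen f).
rewrite /jdim [nwords d n.+1]nwordsS mulnBr.
move/(leq_mul (leqnn d)); lia.
Qed.

End Deformation.

Lemma ex_nonroot (K : numFieldType) (q : {poly K}) :
  q != 0 -> exists t, q.[t] != 0.
Proof.
move=> q0; apply/not_existsP => H.
pose s := [seq i%:R : K | i <- iota 0 (size q)].
have : (size s < size q)%N.
  apply: max_poly_roots => //.
    by apply/allP => t _; apply/eqP; apply: contrapT => /eqP /H.
  by rewrite map_inj_uniq ?iota_uniq //; exact: (@mulrIn _ 1 (oner_neq0 K)).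
by rewrite size_map size_iota ltnn.
Qed.

Section LowerBound.
Variables (K : numFieldType) (d : nat).
Local Notation S := (ncseries K d).
Implicit Types (f g h : S).

(** The numbers [a n] bound the codimension from below for every potential of
order at least [k] as soon as they satisfy the recursion [jdimS] with the
coranks of one potential [f0].  By semicontinuity, a general member [ft] of
the line through [f0] and [f] inherits the coranks of [f0] and the induction
hypothesis applies to it, while its own codimension is at most that of [f]. *)
Lemma jdim_ge_example k (f0 : S) (a c : nat -> nat) :
  (2 <= k)%N -> ord_ge k f0 ->
  (forall q, nwords d q.+1 - jrank q.+1 (jsyz f0) <= c q)%N ->
  a 0 = 0 -> (forall n, a n.+1 + c (n.+2 - k) <= (d * a n).+1)%N ->
  forall n f, ord_ge k f -> (a n <= jdim n f)%N.
Proof.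
move=> k2 Hf0 Hc a0 Ha; elim=> [|n IHn] f Hf; first by rewrite a0.
set q := (n.+2 - k)%N.
have [p1 p1N0 Hp1] := jrank_jsyz_generic q.+1 f0 (f - f0).
have [p2 p2N0 Hp2] := jrank_jgen_generic n.+1 f (f0 - f).
(* On the line, [f0] is the point [t = 0] and [f] the point [1 - t = 0]. *)
have [|t] := @ex_nonroot K (p1 * (p2 \Po (1 - 'X))).
  rewrite mulf_neq0 //; apply: contraNneq p2N0 => E.
  rewrite -[p2]comp_polyXr.
  have -> : 'X = (1 - 'X) \Po (1 - 'X) :> {poly K}.
    by rewrite comp_polyB comp_polyX comp_polyC subKr.
  by rewrite comp_polyA E comp_poly0.
rewrite hornerM mulf_eq0 negb_or horner_comp hornerD hornerN hornerX hornerC.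
move=> /andP[/Hp1 le1 /Hp2 le2].
set ft := f0 + t *: (f - f0) in le1.
have Eft : f + (1 - t) *: (f0 - f) = ft.
  by apply/funext => w; rewrite /ft !(ncseriesDE, ncseriesZE, ncoppE); ring.
rewrite Eft in le2.
have Hft : ord_ge k ft by apply/ord_geD/ord_geZ/ord_geB.
have leq : (n.+2 <= q + k)%N by rewrite /q; lia.
have := jdimS k2 leq Hft; have := Hc q; have := Ha n; have := IHn ft Hft.
have : (jdim n.+1 ft <= jdim n.+1 f)%N by rewrite leq_sub2l.
rewrite -/q => H1 H2 H3 H4.
have : (d * a n <= d * jdim n ft)%N by rewrite leq_mul2l H2 orbT.
have := leq_sub2l (nwords d q.+1) le1.
by move: H1 H3 H4; clear; lia.
Qed.

(** The recursion a_(n+2) >= d a_(n+1) - d a_n + 1 and d >= 4. *)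
Lemma jdim_double n f : (4 <= d)%N -> ord_ge 3 f ->
  ((jdim n f).*2 < jdim n.+1 f)%N.
Proof.
move=> d4 Hf; elim: n => [|n IHn].
  have := @jdimS K d 3 0 0 f isT isT Hf; have := corank_jsyz 0 f.
  by rewrite /jdim /nwords /=; lia.
have leq : (n.+3 <= n + 3)%N by rewrite addn3.
have := @jdimS K d 3 n.+1 n f isT leq Hf; have := corank_jsyz n f.
rewrite -/(jdim n f); nia.
Qed.

End LowerBound.

(** * Spanning by normal words *)

Section NormalWords.
Variables (K : fieldType) (d : nat).
Local Notation S := (ncseries K d).
Local Notation word := (seq 'I_d).
Local Notation mono := (ncmono K).
Implicit Types (f g h : S) (u v w p s : word) (i j : 'I_d).

(** Proportional modulo the ideal.  The factor is nonzero to make the relation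
symmetric. *)
Definition weq f u v := exists2 c : K, c != 0 & jgen f (mono u - c *: mono v).

Lemma weq_refl f u : weq f u u.
Proof.
exists 1; rewrite ?oner_neq0 // scale1r subrr.
exact: (is_ideal0 (is_ideal_jgen f)).
Qed.

Lemma weq_sym f u v : weq f u v -> weq f v u.
Proof.
move=> [c c0 H]; exists c^-1; rewrite ?invr_eq0 //.
have -> : mono v - c^-1 *: mono u = (- c^-1) *: (mono u - c *: mono v).
  by rewrite scalerBr !scaleNr scalerA mulVf // scale1r opprK addrC.
exact: (is_idealZ (is_ideal_jgen f)).
Qed.

Lemma weq_trans f u v w : weq f u v -> weq f v w -> weq f u w.
Proof.
move=> [c c0 H] [c' c0' H']; exists (c * c'); first by rewrite mulf_neq0.
have id := is_ideal_jgen f.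
have -> : mono u - (c * c') *: mono w =
    (mono u - c *: mono v) + c *: (mono v - c' *: mono w).
  by rewrite scalerBr scalerA addrA subrK.
by apply: (is_idealD id) => //; exact: (is_idealZ id).
Qed.

Lemma weq_cat f p s u v : weq f u v -> weq f (p ++ u ++ s) (p ++ v ++ s).
Proof.
move=> [c c0 H]; exists c => //; have id := is_ideal_jgen f.
rewrite -!ncmonoM scalerAr scalerAl -mulrBr -mulrBl.
by apply: (is_idealMl id); exact: (is_idealMr id).
Qed.

Lemma weq_catl f p u v : weq f u v -> weq f (p ++ u) (p ++ v).
Proof. by move=> H; have := weq_cat p [::] H; rewrite !cats0. Qed.

Lemma weq_catr f s u v : weq f u v -> weq f (u ++ s) (v ++ s).
Proof. exact: (@weq_cat f [::]). Qed.

Lemma weq_cder f i u v : cder i f = mono u + mono v -> weq f u v.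
Proof.
move=> E; exists (-1); rewrite ?oppr_eq0 ?oner_neq0 //.
by rewrite scaleN1r opprK -E; exact: cder_jgen.
Qed.

Lemma weq_central f p u :
  (forall i, weq f (rcons p i) (i :: p)) -> weq f (p ++ u) (u ++ p).
Proof.
move=> H; elim: u => [|i u IHu]; first by rewrite cats0; exact: weq_refl.
rewrite -cat_rcons; apply: weq_trans (weq_catr u (H i)) _.
exact: (weq_catl [:: i] IHu).
Qed.

Variables (f : S) (z : 'I_d) (Z : nat -> seq word).

(** The words [w ++ nseq m z] with [w] in [Z l] and [l + m = n]: the families
of normal words used below are stable under right multiplication by the letter
[z], and [Z l] lists those of length [l] that do not arise in this way. *)
Fixpoint normalw n : seq word :=
  Z n ++ if n is n'.+1 then [seq rcons w z | w <- normalw n'] else [::].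

Lemma normal_cat n m w : w \in Z n -> w ++ nseq m z \in normalw (n + m).
Proof.
move=> Zw; elim: m => [|m IHm].
  by rewrite cats0 addn0; case: n Zw => [|n] Zw; rewrite /= mem_cat Zw.
rewrite addnS /= mem_cat; apply/orP; right; apply/mapP.
exists (w ++ nseq m z) => //.
by rewrite -[z :: _]/(nseq m.+1 z) -addn1 nseqD catA cats1.
Qed.

Lemma mem_normalw n w : w \in normalw n ->
  exists l m v, [/\ v \in Z l, (l + m)%N = n & w = v ++ nseq m z].
Proof.
elim: n w => [|n IHn] w /=; rewrite mem_cat => /orP[Zw|//].
- by exists 0, 0, w; rewrite cats0.
- by exists n.+1, 0, w; rewrite cats0 addn0.
case/mapP => v /IHn[l [m [v' [Zv' <- ->]]]] ->.
exists l, m.+1, v'; rewrite addnS; split=> //.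
by rewrite -addn1 nseqD catA cats1.
Qed.

Lemma size_normal n : size (normalw n) = \sum_(m < n.+1) size (Z m).
Proof.
elim: n => [|n IHn]; first by rewrite big_ord1 /= cats0.
by rewrite big_ord_recr /= size_cat size_map IHn addnC.
Qed.

Hypothesis nil_Z : [::] \in Z 0.
Hypothesis normal_step : forall n w i, w \in normalw n -> i != z ->
  exists2 v, v \in normalw n.+1 & weq f (rcons w i) v.

Lemma weq_normal w : exists2 v, v \in normalw (size w) & weq f w v.
Proof.
elim/last_ind: w => [|w i [v Nv wv]].
  by exists [::]; [rewrite /= mem_cat nil_Z | exact: weq_refl].
rewrite size_rcons; have := weq_catr [:: i] wv; rewrite !cats1 => wvi.
have [->|neq] := eqVneq i z.
  exists (rcons v z); last by rewrite -!cats1; exact: weq_catr.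
  by rewrite /= mem_cat; apply/orP; right; apply/mapP; exists v.
have [v' Nv' vv'] := normal_step Nv neq.
by exists v' => //; exact: weq_trans vv'.
Qed.

(** Modulo the multiples [y * x_i] of elements of the ideal, all words are
combinations of the [rcons w i] with [w] normal.  If [i = z] and [w] is a normal
word ending in [z], say [w = rcons v z], then [v * omega] expresses [rcons w z]
by the words [v x_i x_i] with [i != z].  This leaves [rcons w i] with [w] normal
and [i != z], and [rcons w z] with [w] in [Z]. *)
Lemma corank_jsyz_normal q :
  (nwords d q.+1 - jrank q.+1 (jsyz f) <=
     d.-1 * \sum_(n < q) size (normalw n) + \sum_(n < q) size (Z n))%N.
Proof.
pose T1 := [seq rcons w i | w <- flatten [seq normalw n | n <- iota 0 q],
                            i <- enum (predC1 z)].
pose T2 := [seq rcons w z | w <- flatten [seq Z n | n <- iota 0 q]].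
have sumE (F : nat -> seq word) :
    size (flatten [seq F n | n <- iota 0 q]) = (\sum_(n < q) size (F n))%N.
  rewrite size_flatten /shape -map_comp sumnE big_map.
  rewrite -(big_mkord xpredT (fun n => size (F n))).
  by rewrite /index_iota subn0.
pose U := tmx q.+1
  (fun l : 'I_(size (T1 ++ T2)) => mono (nth [::] (T1 ++ T2) l)).
apply: (@leq_trans (\rank U)); last first.
  apply: leq_trans (rank_leq_row _) _.
  rewrite size_cat size_allpairs size_map !sumE -cardE cardC1 card_ord.
  by rewrite mulnC.
apply: corank_le.
set V := (_ + U)%MS.
have HT w : w \in T1 ++ T2 -> (jet q.+1 (mono w) <= V)%MS.
  move=> Tw; apply: submx_trans (addsmxSr _ _).
  have lt : (index w (T1 ++ T2) < size (T1 ++ T2))%N by rewrite index_mem.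
  by apply: (eq_row_sub (Ordinal lt)); rewrite rowK /= nth_index.
have HL g : jsyz f g -> (jet q.+1 g <= V)%MS.
  move=> Lg; apply: submx_trans (addsmxSl _ _).
  by have [_ _] := jet_basisP q.+1 (jsyz f); exact.
have id := is_ideal_jgen f.
have Hweq u v i : weq f u v -> (jet q.+1 (mono (rcons v i)) <= V)%MS ->
    (jet q.+1 (mono (rcons u i)) <= V)%MS.
  move=> [c _ Hc] Hv.
  have -> : mono (rcons u i) = (mono u - c *: mono v) * ncvar K i +
      c *: mono (rcons v i).
    by rewrite mulrBl -scalerAl /ncvar !ncmonoM !cats1 subrK.
  rewrite jetD jetZ; apply: addmx_sub; last exact: scalemx_sub.
  apply: HL; exists 0, 0, (fun j => (j == i)%:R * (mono u - c *: mono v)).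
  split=> [j|]; first exact: (is_idealMl id).
  rewrite scale0r mul0r !add0r (bigD1 i) //= eqxx mul1r big1 ?addr0 //.
  by move=> j /negPf ->; rewrite !mul0r.
have HA n u v i : (n < q)%N -> i != z -> v \in normalw n -> weq f u v ->
    (jet q.+1 (mono (rcons u i)) <= V)%MS.
  move=> ltq neq Nv uv; apply: Hweq uv _; apply: HT; rewrite mem_cat.
  apply/orP; left; apply/allpairsP; exists (v, i); split=> //=.
    by apply/flatten_mapP; exists n => //; rewrite mem_iota.
  by rewrite mem_enum.
case/lastP => [_|w i].
  apply: HL; exists 1, 0, (fun=> 0); split=> [_|]; first exact: (is_ideal0 id).
  by rewrite scale1r mul0r addr0 big1 ?addr0 // => j _; rewrite mul0r.
rewrite size_rcons ltnS => ltq; have [v Nv wv] := weq_normal w.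
have [->{i}|neq] := eqVneq i z; last exact: HA Nv wv.
apply: Hweq wv _; case: (boolP (v \in Z (size w))) => Zv.
  apply: HT; rewrite mem_cat; apply/orP; right; apply/mapP; exists v => //.
  by apply/flatten_mapP; exists (size w) => //; rewrite mem_iota.
move: (size w) ltq Nv Zv => {w} [|n] ltq /=; rewrite mem_cat => /orP[->//|//].
case/mapP => w Nw -> _.
have -> : mono (rcons (rcons w z) z) =
    mono w * omega K d - \sum_(i | i != z) mono (rcons (rcons w i) i).
  rewrite /omega mulr_sumr (bigD1 z) //= -[LHS]addr0 -addrA; congr (_ + _).
    by rewrite /ncvar !ncmonoM -!cats1 -catA.
  apply/esym/eqP; rewrite subr_eq0; apply/eqP; apply: eq_bigr => i _.
  by rewrite /ncvar !ncmonoM -!cats1 -catA.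
rewrite -scaleN1r jetD jetZ; apply: addmx_sub.
  apply: HL; exists 0, (mono w), (fun=> 0).
  split=> [_|]; first exact: (is_ideal0 id).
  by rewrite scale0r add0r big1 ?addr0 // => j _; rewrite mul0r.
apply: scalemx_sub; rewrite big_mkcond jet_sum; apply: summx_sub => i _.
case: ifP => neq; last by rewrite (_ : jet _ 0 = 0) ?sub0mx //; apply/jet_eq0.
have [v' Nv' vv'] := normal_step Nw neq.
exact: HA Nv' vv'.
Qed.

End NormalWords.

(** * Two explicit potentials *)

Section Growth.
Implicit Type z : nat -> nat.

(** The number of normal words of length less than [n] if [z l] is the number
of those of length [l] that do not end in the distinguished letter. *)
Definition sum2 z n : nat := \sum_(m < n) \sum_(l < m.+1) z l.

Lemma sum2S z n : sum2 z n.+1 = (sum2 z n + \sum_(l < n.+1) z l)%N.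
Proof. by rewrite /sum2 big_ord_recr. Qed.

Lemma sum2_cube z n : (forall m, m < 2 * z m)%N -> (n ^ 3 <= 12 * sum2 z n)%N.
Proof.
move=> Hz.
have H1 m : (m * m.+1 <= 4 * \sum_(l < m) z l)%N.
  elim: m => [|m IHm]; first by rewrite big_ord0.
  rewrite big_ord_recr /=; have := Hz m.
  by move: (\sum_(l < m) z l)%N (z m) IHm => s t; nia.
have H2 : (n * n.+1 * n.+2 <= 12 * sum2 z n)%N.
  rewrite /sum2; elim: n => [|n IHn]; first by rewrite big_ord0.
  rewrite big_ord_recr /=; have := H1 n.+1.
  by move: (\sum_(m < n) _)%N (\sum_(l < n.+1) _)%N IHn => s t; nia.
by apply: leq_trans H2; rewrite !expnS; nia.
Qed.

(** Equality holds for [z l = l.+1], when the generating series of [sum2 z] is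
t/(1-t)^4; the coefficients are those of 1 - 3t + 3t^2 - t^3. *)
Lemma sum2_3 z n : (forall m, z m.+1 <= (z m).+1)%N -> (z 0 <= 1)%N ->
  (sum2 z n.+1 + (2 * sum2 z (n.+2 - 3) + \sum_(l < n.+2 - 3) z l) <=
     (3 * sum2 z n).+1)%N.
Proof.
move=> Hz z0; case: n => [|n].
  by rewrite !sum2S /sum2 /= !big_ord_recr !big_ord0 /=; lia.
have -> : (n.+3 - 3 = n)%N by lia.
by rewrite !sum2S !big_ord_recr /=; have := Hz n; lia.
Qed.

(** Equality holds for [z l = l./2.+1]; the coefficients are those of
1 - 2t + 2t^3 - t^4, the product of (1-t)^3 and 1+t. *)
Lemma sum2_4 z n : (forall m, z m.+2 <= (z m).+1)%N ->
    (z 0 <= 1)%N -> (z 1 <= 1)%N ->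
  (sum2 z n.+1 + (sum2 z (n.+2 - 4) + \sum_(l < n.+2 - 4) z l) <=
     (2 * sum2 z n).+1)%N.
Proof.
move=> Hz z0 z1; case: n => [|[|n]].
- by rewrite !sum2S /sum2 /= !big_ord_recr !big_ord0 /=; lia.
- by rewrite !sum2S /sum2 /= !big_ord_recr !big_ord0 /=; lia.
have -> : (n.+4 - 4 = n)%N by lia.
by rewrite !sum2S !big_ord_recr /=; have := Hz n; lia.
Qed.

End Growth.

Section Examples.
Variable K : numFieldType.
Local Notation mono := (ncmono K).

Lemma jdim_ge_normal d k (f0 : ncseries K d) (y : 'I_d)
    (Z : nat -> seq (seq 'I_d)) :
  (2 <= k)%N -> ord_ge k f0 -> [::] \in Z 0 ->
  (forall n w i, w \in normalw y Z n -> i != y ->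
     exists2 v, v \in normalw y Z n.+1 & weq f0 (rcons w i) v) ->
  let z n := size (Z n) in
  (forall n, sum2 z n.+1 + (d.-1 * sum2 z (n.+2 - k) + \sum_(l < n.+2 - k) z l)
     <= (d * sum2 z n).+1)%N ->
  forall n (f : ncseries K d), ord_ge k f -> (sum2 z n <= jdim n f)%N.
Proof.
move=> k2 Hf0 Z0 step z Hz n f Hf.
pose c q := (d.-1 * sum2 z q + \sum_(l < q) z l)%N.
apply: (@jdim_ge_example _ _ k f0 (sum2 z) c) => //; last first.
  by rewrite /sum2 big_ord0.
move=> q; have := corank_jsyz_normal Z0 step q.
by under eq_bigr do rewrite size_normal.
Qed.

Section TwoVariables.
Local Notation x := (@Ordinal 2 0 isT).
Local Notation y := (@Ordinal 2 1 isT).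

(** Its derivatives are x y y + y y x and y x x + x x y: modulo these, x x and
y y commute with all letters up to sign. *)
Definition pot2 : ncseries K 2 := mono [:: x; x; y; y].

Definition alt n : seq 'I_2 := flatten (nseq n [:: x; y]).

(** The words y^a (xy)^b of length [n]. *)
Definition normal2 n : seq (seq 'I_2) :=
  [seq nseq (n - m.*2) y ++ alt m | m <- iota 0 n./2.+1].

Lemma altSr n : alt n.+1 = alt n ++ [:: x; y].
Proof. by rewrite /alt -(addn1 n) nseqD flatten_cat. Qed.

Lemma cder_pot2_x : cder x pot2 = mono [:: x; y; y] + mono [:: y; y; x].
Proof.
rewrite /pot2 cder_mono /cder_word big_mkcond !big_ord_recl big_ord0 /=.
by rewrite !addr0.
Qed.

Lemma cder_pot2_y : cder y pot2 = mono [:: y; x; x] + mono [:: x; x; y].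
Proof.
rewrite /pot2 cder_mono /cder_word big_mkcond !big_ord_recl big_ord0 /=.
by rewrite !addr0 !add0r.
Qed.

Lemma ord2P (i : 'I_2) : i = x \/ i = y.
Proof.
by case: i => -[|[|//]] lt; [left | right]; apply: val_inj.
Qed.

Lemma weq_xx u : weq pot2 ([:: x; x] ++ u) (u ++ [:: x; x]).
Proof.
apply: weq_central => i; case: (ord2P i) => ->; first exact: weq_refl.
exact/weq_sym/weq_cder/cder_pot2_y.
Qed.

Lemma weq_yy u : weq pot2 (u ++ [:: y; y]) ([:: y; y] ++ u).
Proof.
apply/weq_sym/weq_central => i; case: (ord2P i) => ->; last exact: weq_refl.
exact/weq_sym/weq_cder/cder_pot2_x.
Qed.

Lemma weq_nseq_even n : weq pot2 (nseq n.*2 x ++ [:: y]) (y :: nseq n.*2 x).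
Proof.
elim: n => [|n IHn]; first exact: weq_refl.
rewrite doubleS; apply: weq_trans (weq_catl [:: x; x] IHn) _.
exact: (weq_catr (nseq n.*2 x) (weq_xx [:: y])).
Qed.

Lemma normal2_mem a b c n : (a + b.*2 + c)%N = n ->
  nseq a y ++ alt b ++ nseq c x \in normalw x normal2 n.
Proof.
move=> <-; rewrite catA; apply: normal_cat; apply/mapP; exists b.
  by rewrite mem_iota; lia.
by rewrite addnK.
Qed.

(** Multiply y^a (xy)^b x^c by y on the right.  The largest even power of x in
x^c can be moved to the end.  If c is odd, a letter x is left before the new y
and b increases.  If c is even and b > 0, the block x y y at the end of (xy)^b y
becomes y y x, and y y moves to the front. *)
Lemma normal2_step n w i : w \in normalw x normal2 n -> i != x ->
  exists2 v, v \in normalw x normal2 n.+1 & weq pot2 (rcons w i) v.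
Proof.
move=> /mem_normalw[l [c [v [/mapP[b]]]]]; rewrite mem_iota.
move=> lb -> <- -> {v w}.
case: (ord2P i) => ->; first by rewrite eqxx.
move=> _; have El : (l - b.*2 + b.*2)%N = l by lia.
move: (l - b.*2)%N El => a El.
rewrite -cats1 -!catA.
have [e Ec] : exists e, c = (odd c + e.*2)%N.
  by exists c./2; rewrite odd_double_half.
case: (odd c) Ec; rewrite ?add1n ?add0n => -> {c}.
  exists (nseq a y ++ alt b.+1 ++ nseq e.*2 x).
    by apply: normal2_mem; lia.
  rewrite altSr -catA; do 2!apply: weq_catl.
  exact: (weq_catl [:: x] (weq_nseq_even e)).
have H1 : weq pot2 (nseq a y ++ alt b ++ nseq e.*2 x ++ [:: y])
    (nseq a y ++ alt b ++ [:: y] ++ nseq e.*2 x).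
  by do 2!apply: weq_catl; exact: weq_nseq_even.
case: b {lb} El H1 => [|b] El H1.
  exists (nseq a.+1 y ++ alt 0 ++ nseq e.*2 x).
    by apply: normal2_mem; lia.
  by apply: weq_trans H1 _; rewrite -(addn1 a) nseqD -catA; exact: weq_refl.
exists (nseq a.+2 y ++ alt b ++ nseq e.*2.+1 x).
  by apply: normal2_mem; lia.
apply: weq_trans H1 _; rewrite -(addn2 a) nseqD -catA; apply: weq_catl.
rewrite altSr -catA /=.
apply: (weq_trans (v := alt b ++ [:: y; y] ++ nseq e.*2.+1 x)).
  by apply: weq_catl; apply: (@weq_catr _ _ _ _ [:: x; y; y] [:: y; y; x]);
    exact/weq_cder/cder_pot2_x.
by rewrite catA; exact: (weq_catr _ (weq_yy (alt b))).
Qed.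

Lemma jdim_cube2 n (f : ncseries K 2) :
  ord_ge 4 f -> (n ^ 3 <= 12 * jdim n f)%N.
Proof.
move=> Hf.
have zE m : size (normal2 m) = m./2.+1 by rewrite size_map size_iota.
apply: (@leq_trans (12 * sum2 (fun m => size (normal2 m)) n)%N).
  by apply: sum2_cube => m; rewrite zE; lia.
rewrite leq_mul2l /=.
apply: (jdim_ge_normal (k := 4) (f0 := pot2) (y := x) _ _ _ normal2_step) => //.
  exact: (@ord_ge_mono _ _ [:: x; x; y; y]).
move=> m; rewrite mul1n; apply: sum2_4 => [l| |];
  by rewrite !zE //; lia.
Qed.

End TwoVariables.

Section ThreeVariables.
Local Notation x := (@Ordinal 3 0 isT).
Local Notation y := (@Ordinal 3 1 isT).
Local Notation z := (@Ordinal 3 2 isT).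

(** Its derivatives are the sums y z + z y, z x + x z and x y + y x: modulo
these, any two letters commute up to sign. *)
Definition pot3 : ncseries K 3 := mono [:: x; y; z] + mono [:: x; z; y].

(** The words x^a y^b of length [n]. *)
Definition normal3 n : seq (seq 'I_3) :=
  [seq nseq m x ++ nseq (n - m) y | m <- iota 0 n.+1].

Lemma ord3P (i : 'I_3) : [\/ i = x, i = y | i = z].
Proof.
by case: i => -[|[|[|//]]] lt;
  [apply: Or31 | apply: Or32 | apply: Or33]; apply: val_inj.
Qed.

Lemma cder_pot3_x : cder x pot3 = mono [:: y; z] + mono [:: z; y].
Proof.
rewrite /pot3 cderD !cder_mono /cder_word !(big_mkcond (fun _ => _ == _)) /=.
rewrite !big_ord_recl !big_ord0 /=.
by rewrite !addr0.
Qed.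

Lemma cder_pot3_y : cder y pot3 = mono [:: z; x] + mono [:: x; z].
Proof.
rewrite /pot3 cderD !cder_mono /cder_word !(big_mkcond (fun _ => _ == _)) /=.
rewrite !big_ord_recl !big_ord0 /=.
by rewrite !addr0 !add0r.
Qed.

Lemma cder_pot3_z : cder z pot3 = mono [:: x; y] + mono [:: y; x].
Proof.
rewrite /pot3 cderD !cder_mono /cder_word !(big_mkcond (fun _ => _ == _)) /=.
rewrite !big_ord_recl !big_ord0 /=.
by rewrite !addr0 !add0r.
Qed.

Lemma weq_comm i u : weq pot3 (u ++ [:: i]) (i :: u).
Proof.
apply/weq_sym/(@weq_central _ _ _ [:: i]) => j.
have Hyz := weq_cder cder_pot3_x; have Hzx := weq_cder cder_pot3_y.
have Hxy := weq_cder cder_pot3_z.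
by case: (ord3P i) => ->; case: (ord3P j) => -> //; try exact: weq_refl;
  apply: weq_sym.
Qed.

Lemma normal3_mem a b c n : (a + b + c)%N = n ->
  nseq a x ++ nseq b y ++ nseq c z \in normalw z normal3 n.
Proof.
move=> <-; rewrite catA; apply: normal_cat; apply/mapP; exists a.
  by rewrite mem_iota; lia.
by rewrite addKn.
Qed.

Lemma normal3_step n w i : w \in normalw z normal3 n -> i != z ->
  exists2 v, v \in normalw z normal3 n.+1 & weq pot3 (rcons w i) v.
Proof.
move=> /mem_normalw[l [c [v [/mapP[a]]]]]; rewrite mem_iota.
move=> la -> <- -> {v w}.
have El : (a + (l - a))%N = l by lia.
move: (l - a)%N El => b El.
rewrite -cats1 -!catA; case: (ord3P i) => -> // _.
  exists (nseq a.+1 x ++ nseq b y ++ nseq c z).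
    by apply: normal3_mem; lia.
  rewrite -(addn1 a) nseqD -catA; apply: weq_catl; rewrite catA.
  exact: weq_comm.
exists (nseq a x ++ nseq b.+1 y ++ nseq c z); first by apply: normal3_mem; lia.
by rewrite -(addn1 b) nseqD -catA; do 2!apply: weq_catl; exact: weq_comm.
Qed.

Lemma jdim_cube3 n (f : ncseries K 3) :
  ord_ge 3 f -> (n ^ 3 <= 12 * jdim n f)%N.
Proof.
move=> Hf.
have sE m : size (normal3 m) = m.+1 by rewrite size_map size_iota.
apply: (@leq_trans (12 * sum2 (fun m => size (normal3 m)) n)%N).
  by apply: sum2_cube => m; rewrite sE; lia.
rewrite leq_mul2l /=.
apply: (jdim_ge_normal (k := 3) (f0 := pot3) (y := z) _ _ _ normal3_step) => //.
  apply: ord_geD; first exact: (@ord_ge_mono _ _ [:: x; y; z]).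
  exact: (@ord_ge_mono _ _ [:: x; z; y]).
by move=> m; apply: sum2_3 => [l|]; rewrite !sE.
Qed.

End ThreeVariables.

Lemma jdim_cube d n (f : ncseries K d) :
  (4 <= d)%N -> ord_ge 3 f -> (n ^ 3 <= 12 * jdim n f)%N.
Proof.
move=> d4 Hf; elim: n => // n; have := jdim_double n d4 Hf.
rewrite !expnS; case: n => [|[|[|n]]]; nia.
Qed.

End Examples.

(** * Powers of the radical of the Jacobi algebra *)

Section Jacobi.
Local Open Scope quotient_scope.
Variables (K : fieldType) (d : nat) (f : ncseries K d).
Hypothesis Hf : ord_ge 2 f.
Local Notation S := (ncseries K d).
Local Notation piJ := (\pi_(quot_ring (jac_ideal f))).
Implicit Types (g h : S).

(** The closure is not seen by jets. *)
Lemma jac_ideal_jgen n g : ideal_set (jac_ideal f) g ->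
  exists2 h, jgen f h & ord_ge n (g - h).
Proof.
move=> /(_ n I)[h Hh [h' Hh' <-]]; exists h => //.
by rewrite addrC addKr; exact: ideal_exp_nc_max.
Qed.

Lemma jac_ideal_nc_max g : ideal_set (jac_ideal f) g -> nc_max g.
Proof.
move=> /(jac_ideal_jgen 1)[h /(jgen_ord_ge Hf) Hh Hg].
by rewrite /nc_max /= -[g](subrK h) ncseriesDE Hg // Hh // addr0.
Qed.

Lemma piJ_eq g h : piJ g = piJ h -> ideal_set (jac_ideal f) (g - h).
Proof. by move=> /eqP/quot_ring_eqP. Qed.

Lemma piJB g h : piJ (g - h) = piJ g - piJ h :> Jac f.
Proof.
by apply/eqP; rewrite eq_sym subr_eq -[X in _ == X]quot_ring_pi_add subrK.
Qed.

Lemma piJM g h : piJ (g * h) = (piJ g : Jac f) * piJ h.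
Proof. exact: quot_pi_mul. Qed.

Lemma piJ_comb r (c : 'I_r -> K) (s : 'I_r -> S) :
  piJ (\sum_l c l *: s l) = \sum_l c l *: (piJ (s l) : Jac f).
Proof.
elim/big_rec2: _ => [|l x g _ <-]; first by rewrite -[0 in LHS]subr0 piJB subrr.
by rewrite quot_ring_pi_add quot_pi_scale.
Qed.

(** The ideal is proper because the derivatives have no constant term, and
maximal because the series without constant term have codimension one. *)
Lemma is_max_left_ideal_nc_max :
  is_max_left_ideal [set x : Jac f | exists2 g, nc_max g & x = piJ g].
Proof.
have [[m0 mB mMl] _] := is_ideal_nc_max K d.
split.
- split.
  + by exists 0 => //; rewrite -[0 in RHS](subrr 0) piJB subrr.
  + move=> _ _ [g Hg ->] [h Hh ->]; exists (g - h); first exact: mB.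
    by rewrite piJB.
  + move=> a _ [g Hg ->]; exists (repr a * g); first exact: mMl.
    by rewrite piJM reprK.
- move=> E.
  have : [set x : Jac f | exists2 g, nc_max g & x = piJ g] (piJ 1) by rewrite E.
  move=> [g Hg /piJ_eq/jac_ideal_nc_max].
  rewrite /nc_max /= ncseriesDE ncoppE Hg subr0 => /eqP.
  by rewrite (oner_eq0 K).
- move=> J [J0 JB JMl] sub.
  have [[x [Jx nx]]|H] := pselect (exists x, J x /\
      ~ exists2 g, nc_max g & x = piJ g); last first.
    left; apply/seteqP; split=> // x Jx.
    by apply: contrapT => nx; apply: H; exists x.
  right; apply/seteqP; split=> // y _.
  have g0 : repr x [::] != 0.
    by apply/eqP => g0; apply: nx; exists (repr x) => //; rewrite reprK.
  set g := repr x in g0; have xE : x = piJ g by rewrite reprK.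
  suff J1 : J (piJ 1) by have := JMl y _ J1; rewrite mulr1.
  pose u : S := (g [::])^-1 *: 1.
  have -> : 1 = u * g - (u * g - 1) by rewrite subKr.
  rewrite piJB; apply: JB; first by rewrite piJM -xE; exact: JMl.
  apply: sub; exists (u * g - 1) => //.
  rewrite /nc_max /= ncseriesDE ncoppE /u -scalerAl mul1r ncseriesZE mulVf //.
  exact: subrr.
Qed.

(** The radical is contained in the maximal left ideal of
[is_max_left_ideal_nc_max]. *)
Lemma ideal_exp_jacobson n (x : Jac f) :
  ideal_exp (@jacobson_radical (Jac f)) n x ->
  exists2 g, ord_ge n g & x = piJ g.
Proof.
elim: n x => [|n IHn] x /=.
  by move=> _; exists (repr x) => //; rewrite reprK.
move=> [m [a [b [Ha Hb ->]]]].
have Ha' l : exists g, nc_max g /\ a l = piJ g.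
  by have [g] := Ha l _ is_max_left_ideal_nc_max; exists g.
have Hb' l : exists g, ord_ge n g /\ b l = piJ g.
  by have [g] := IHn _ (Hb l); exists g.
have [u Hu] := choice Ha'; have [v Hv] := choice Hb'.
exists (\sum_l 1 *: (u l * v l)).
  apply: ord_ge_sum => l; apply: ord_geZ; rewrite -add1n; apply: ord_geM.
    by case=> // _; have [] := Hu l.
  by have [] := Hv l.
rewrite piJ_comb; apply: eq_bigr => l _.
by have [_ ->] := Hu l; have [_ ->] := Hv l; rewrite scale1r piJM.
Qed.

(** Series whose jets form a basis of a complement of the jets of the ideal stay
independent modulo the [n]-th power of the radical. *)
Lemma quot_dim_ge_jdim (R : realType) n :
  ((jdim n f)%:R%:E <=
   quot_dim R (ideal_exp (@jacobson_radical (Jac f)) n : set (Jac f)))%E.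
Proof.
apply: ereal_sup_ubound; exists (jdim n f) => //.
have [h [free_h /eqmxP eqh]] := ex_jet_complement n (jgen f).
exists (fun l => piJ (h l)) => c; rewrite -piJ_comb.
move=> /ideal_exp_jacobson[g Hg] /piJ_eq/(jac_ideal_jgen n)[y Hy Hgy].
pose v := \row_l c l.
have vE : v *m tmx n h = jet n (\sum_l c l *: h l).
  by rewrite tmx_mul; congr jet; apply: eq_bigr => l _; rewrite mxE.
have Ey : jet n (\sum_l c l *: h l) = jet n y.
  apply: jet_eq; rewrite -[X in X - y](subrK g) addrAC.
  exact: ord_geD.
have : (v *m tmx n h <= tmx n (jet_basis n (jgen f)) :&:
    (tmx n (jet_basis n (jgen f)))^C)%MS.
  rewrite sub_capmx eqh submxMl andbT vE Ey.
  by have [_ _] := jet_basisP n (jgen f); exact.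
rewrite capmx_compl submx0 => /eqP v0 l.
have /rowP/(_ l) : v = 0 by apply: (row_free_inj free_h); rewrite v0 mul0mx.
by rewrite !mxE.
Qed.

End Jacobi.


(** * The growth exponent *)

Lemma cube_le_powR (R : realType) (r c : R) :
  (forall n : nat, n%:R ^+ 3 <= c * n%:R `^ r) -> 3 <= r.
Proof.
move=> H; rewrite leNgt; apply/negP => r3.
pose e := 3 - r; have e0 : 0 < e by rewrite subr_gt0.
have He (n : nat) : (0 < n)%N -> n%:R `^ e <= c.
  move=> n0; have n0' : 0 < (n%:R : R) by rewrite ltr0n.
  rewrite -(ler_pM2r (powR_gt0 r n0')) -powRD; last first.
    by apply/implyP => _; rewrite gt_eqF.
  by rewrite /e subrK powR_mulrn ?ler0n.
have c1 : 1 <= c by have := He 1 isT; rewrite powR1.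
have c0 : 0 < c by exact: lt_le_trans c1.
(* This is larger than the positive number whose [e]-th power is [c]. *)
pose n := (Num.truncn (c `^ e^-1)).+1.
have := He n isT; apply/negP; rewrite -ltNge.
have {1}-> : c = (c `^ e^-1) `^ e by rewrite -powRrM mulVf ?gt_eqF ?powRr1 ?ltW.
apply: gt0_ltr_powR => //; rewrite ?nnegrE ?powR_ge0 ?ler0n //.
by rewrite /n truncnS_gt.
Qed.


Local Open Scope complex_scope.

Theorem theoremA13 (R : realType) (d k : nat)
    (hdk : (d = 2%N /\ (4 <= k)%N) \/ ((3 <= d)%N /\ (3 <= k)%N))
    (f : ncseries R[i] d) (hf : has_order f k) :
  (3%:E <= J_dim R f)%E.
Proof.
have Hf := has_order_ord_ge hf.
have Hcube n : (n ^ 3 <= 12 * jdim n f)%N.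
  case: hdk => [[d2 k4]|[d3 k3]].
    by move: d2 f Hf {hf} => -> f Hf; apply: jdim_cube2; exact: ord_geW Hf.
  have {}Hf := ord_geW k3 Hf.
  have [d4|] := ltnP 3 d; first exact: jdim_cube.
  move=> d4; have d3' : d = 3%N by apply/eqP; rewrite eqn_leq d4.
  by move: d3' f Hf {hf d3 d4} => -> f Hf; exact: jdim_cube3.
have Hf2 : ord_ge 2 f by apply: ord_geW Hf; case: hdk => -[]; lia.
apply/ereal_infP => _ [r [r0 [c Hc]] <-]; rewrite lee_fin.
apply: (@cube_le_powR _ _ (12 * c)) => n.
have := le_trans (quot_dim_ge_jdim Hf2 R n) (Hc n); rewrite lee_fin => le.
rewrite -mulrA; apply: le_trans (ler_wpM2l _ le) => //.
by rewrite -natrX -natrM ler_nat.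
Qed.
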